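(* Let $b>0$, $\alpha\in(0,\frac12)$, and let $\omega=(\omega_x)_{x\ge 1}$ be a sequence of i.i.d. real random variables with law $\mathbb{P}$ (expectation $\mathbb{E}$) such that $\mathbb{E}[\omega_1]=0$, $\sigma^2:=\mathbb{E}[\omega_1^2]\in(0,+\infty)$, and there exists $\theta_0>0$ such that $\mathbb{E}[e^{\theta\omega_1}]<\infty$ for all $|\theta|<\theta_0$. Let $X$ be the continuous-time random walk in the environment $\omega$ on $\mathbb{Z}^+$ started at $0$ (as described in the context), with quenched law $\mathtt{P}_\omega$. For $\varepsilon\in(0,1)$ let $\tau_{(1-\varepsilon)s(t)}$ be the first hitting time by $X$ of the point $\lfloor(1-\varepsilon)s(t)\rfloor$, where $s(t)=\bigl(C^*(\ln\ln t)^{-1}\ln t\bigr)^{1/\alpha}$ and $C^*=\frac{2\alpha b}{\sigma^2(1-2\alpha)}$. Then for all $\varepsilon\in(0,1)$ there exists $\delta>0$ such that, for $\mathbb{P}$-almost every $\omega$, $$\mathtt{P}_\omega\bigl[\tau_{(1-\varepsilon)s(t)}>t\bigr]\le \exp\{-t^{\delta/2}\}$$ for all $t$ large enough.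
   Context: $\mathbb{Z}^+=\{0,1,2,\dots\}$. Given $\omega$, set $q_0=0$ and $q_y=\dfrac{\exp(\omega_y-by^{-\alpha})}{1+\exp(\omega_y-by^{-\alpha})}$ for integers $y\ge1$. For fixed $\omega$, the random walk $X$ is the continuous-time nearest-neighbour Markov chain on $\mathbb{Z}^+$ with transition probabilities, as $h\to0$, $\mathtt{P}_\omega[X_{t+h}=y+1\mid X_t=y]=(1-q_y)h+o(h)$ for $y\ge0$, and $\mathtt{P}_\omega[X_{t+h}=y-1\mid X_t=y]=q_yh+o(h)$ for $y\ge1$. $\mathtt{P}_\omega$ denotes the (quenched) law of $X$ started from $0$ in the fixed environment $\omega$. The first hitting time of $x\in\mathbb{Z}^+$ is $\tau_x=\inf\{t>0: X_t=x\}$. How large $t$ has to be may depend on $\omega$. *)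

(* Defs.v *)
From HB Require Import structures.
From mathcomp Require Import all_boot all_order all_algebra.
From mathcomp Require Import all_classical all_reals all_analysis.
Set Implicit Arguments.
Unset Strict Implicit.
Unset Printing Implicit Defensive.
Import Order.TTheory GRing.Theory Num.Theory.
Import numFieldNormedType.Exports.
Local Open Scope classical_set_scope.
Local Open Scope ring_scope.

Definition independent_on (d : measure_display) (T : measurableType d)
    (R : realType) (P : probability T R) (D : set nat)
    (omega : nat -> {RV P >-> R}) : Prop :=
  forall (s : seq nat) (B : nat -> set R),
    uniq s -> (forall x, x \in s -> D x) -> (forall x, measurable (B x)) ->
    P (\big[setI/setT]_(x <- s) (omega x @^-1` B x)) =
    (\prod_(x <- s) P (omega x @^-1` B x))%E.

Definition same_law (d : measure_display) (T : measurableType d)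
    (R : realType) (P : probability T R) (X Y : {RV P >-> R}) : Prop :=
  forall B : set R, measurable B -> distribution P X B = distribution P Y B.

(* The environment is [(omega x)] for [x >= 1]; [omega 0] is unconstrained and
   never used. *)
Definition iid_environment (d : measure_display) (T : measurableType d)
    (R : realType) (P : probability T R) (omega : nat -> {RV P >-> R}) : Prop :=
  independent_on [set x | (1 <= x)%N] omega /\
  (forall x, (1 <= x)%N -> same_law (omega x) (omega 1%N)).

Definition jump_left (R : realType) (b alpha : R) (om : nat -> R) (y : nat) : R :=
  if y == 0%N then 0 else
  let u := om y - b * y%:R `^ (- alpha) in expR u / (1 + expR u).

(* [p t y z] is the probability of being at [z] a time [t] after being at [y]. *)
Record transition_function (R : realType) (p : R -> nat -> nat -> R) : Prop := {
  transition_ge0 : forall (t : R) y z, 0 <= t -> 0 <= p t y z;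
  transition_sum1 : forall (t : R) y, 0 <= t ->
    (\sum_(z <oo) (p t y z)%:E = 1)%E;
  transition0 : forall y z, p 0 y z = (y == z)%:R;
  transitionD : forall (s t : R) x z, 0 <= s -> 0 <= t ->
    ((p (s + t) x z)%:E = \sum_(y <oo) (p s x y * p t y z)%:E)%E }.

(* In [nn_other], the sum runs over [y - 1], [y], [y + 1] (over [0], [1] when
   [y = 0]): within a time [h], the chain moves by more than one unit only with
   probability [o(h)]. *)
Record nearest_neighbour_rates (R : realType) (q : nat -> R)
    (p : R -> nat -> nat -> R) : Prop := {
  nn_right : forall y,
    (fun h : R => p h y y.+1 - (1 - q y) * h) =o_ (0^'+) (fun h : R => h);
  nn_left : forall y, (1 <= y)%N ->
    (fun h : R => p h y y.-1 - q y * h) =o_ (0^'+) (fun h : R => h);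
  nn_other : forall y,
    (fun h : R => 1 - \sum_(y.-1 <= z < y.+2) p h y z) =o_ (0^'+)
      (fun h : R => h) }.

(* The Markov property is in product form, so as to need no convention for
   conditioning on null events; the past is given by the positions at finitely
   many arbitrary times [u.1] in [0, t]. *)
Record markov_chain (d : measure_display) (T : measurableType d)
    (R : realType) (P : probability T R) (p : R -> nat -> nat -> R)
    (X : R -> T -> nat) : Prop := {
  chain_measurable : forall t : R, 0 <= t -> measurable_fun [set: T] (X t);
  chain_right_continuous : forall w (t : R), 0 <= t ->
    \forall s \near t^'+, X s w = X t w;
  chain_markov : forall (past : seq (R * nat)) (t h : R) y z, 0 <= t -> 0 <= h ->
    (forall u, u \in past -> 0 <= u.1 <= t) ->
    let past_event := [set w | forall u, u \in past -> X u.1 w = u.2] in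
    P (past_event `&` [set w | X t w = y] `&` [set w | X (t + h) w = z]) =
    (P (past_event `&` [set w | X t w = y]) * (p h y z)%:E)%E }.

(* [P] is the quenched law of [X] in the fixed environment [om]. *)
Definition quenched_walk (d : measure_display) (T : measurableType d)
    (R : realType) (b alpha : R) (om : nat -> R) (P : probability T R)
    (X : R -> T -> nat) : Prop :=
  P [set w | X 0 w = 0%N] = 1%E /\
  exists p, [/\ transition_function p,
    nearest_neighbour_rates (jump_left b alpha om) p & markov_chain P p X].

(* The value is [+oo] when [x] is never hit. *)
Definition hitting_time (T : Type) (R : realType) (X : R -> T -> nat)
    (x : nat) (w : T) : \bar R :=
  ereal_inf [set t%:E | t in [set t : R | 0 < t /\ X t w = x]].

Definition Cstar (R : realType) (b alpha sigma2 : R) : R :=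
  2 * alpha * b / (sigma2 * (1 - 2 * alpha)).

Definition front (R : realType) (b alpha sigma2 : R) (t : R) : R :=
  (Cstar b alpha sigma2 * (ln (ln t))^-1 * ln t) `^ alpha^-1.

(* Main.v *)
Require Import Defs.
From HB Require Import structures.
From mathcomp Require Import all_boot all_order all_algebra.
From mathcomp Require Import all_classical all_reals all_analysis.
From mathcomp Require Import measurable_realfun.
From mathcomp Require Import ring lra zify.
Set Implicit Arguments.
Unset Strict Implicit.
Unset Printing Implicit Defensive.
Import Order.TTheory GRing.Theory Num.Theory.
Import numFieldNormedType.Exports.
Import HBNNSimple.
Local Open Scope classical_set_scope.
Local Open Scope ring_scope.

(** The odds of a step to the left at [y] are [exp (omega_y - b y^-alpha)], so
the walk moves in the potential [V] whose increment at [y] is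
[omega_y - b y^-alpha], and what delays it on its way to [N] is the highest
climb [V j - V i], [i <= j < N].

The walk in a fixed environment. If no climb before [N] exceeds [M], then the
expected time [g y] to go from [y] to [N] is at most [G = 2 N^2 e^M]. The
generator sends [g] to [-1], so [f = 1 + g / G] takes its values in [1, 2] and
is sent below [- f / (2 G)]: the walk killed at [N] dies at rate at least
[1 / (2 G)], and [P (tau_N > t) <= 2 exp (- t / (4 N^2 e^M))] ([quenched_tail],
from [lyapunov_function] and [survival_le]). The chain is given by the
behaviour of its transition function near time [0] only; hence the decay is
first proved for the positions at the multiples of a time [h], with an error
[o(h)] at each step, and then [h] goes to [0].

The environment. Write [x = ln t / ln (ln t)] and let [N] be the site
[(1 - epsilon) s(t)], of order [x^(1/alpha)]. Before [N] the drift towards the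
right is at least [A sigma2 (1/alpha - 2) / (2 x)] with
[A = (1 - epsilon)^-alpha > 1] ([drift_ge]). By Chernoff's inequality with a
parameter [kap / x], where [kap] lies strictly between [1/alpha - 2] and
[A (1/alpha - 2)], a climb between two given sites exceeds [ln t] with
probability at most [exp (- kap ln (ln t))], and this bound decreases
geometrically with the distance of the two sites in units of [x^2]. Counting
all sites as starting points would be too much, but over a distance [x^2] the
potential rises by less than a small fraction of [ln t], so that it suffices to
consider the multiples of [x^2] ([climb_le_on_grid]). There are of the order of
[x^(1/alpha - 2)] of them before [N], at most a constant times
[exp ((1/alpha - 2) ln (ln t))]; the constant of [s(t)] is the one for which the
two exponents would agree at [epsilon = 0]. The probability that some climb
exceeds [(1 - delta) ln t] is thus at most a constant times a negative power of
[ln t], which is summable along [ln t = exp (eta k)], and monotonicity in [N]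
fills the gaps ([exists_climb_weight], [environment_climb_le]).

With [M = (1 - delta) ln t] and [N] at most a power of [ln t], the exponent
[t / (4 N^2 e^M)] is [t^delta] up to a power of [ln t], which exceeds
[t^(delta / 2)] for large [t]. *)

(** * A Lyapunov function for the walk before a site *)

(** One more than the expected time [T y] to go from [y] to [y.+1]:
conditioning on the first jump gives [T y = 1 + r y + r y * T y.-1] with [r y]
the odds of a jump to the left, and [1 + T y] satisfies a simpler recursion. *)
Fixpoint exit_cost (R : realType) (r : nat -> R) (y : nat) : R :=
  if y is y'.+1 then 2 + r y * exit_cost r y' else 2.

Lemma exit_costE (R : realType) (r : nat -> R) (y : nat) :
  exit_cost r y = 2 * \sum_(i < y.+1) \prod_(i.+1 <= l < y.+1) r l.
Proof.
elim: y => [|y IH] /=; first by rewrite big_ord_recl big_ord0 big_geq// addr0 mulr1.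
rewrite [in RHS]big_ord_recr /= [in RHS](@big_geq _ _ _ y.+2)// mulrDr mulr1 addrC IH.
congr (_ + _); rewrite mulrCA mulr_sumr; congr (_ * _); apply: eq_bigr => i _.
by rewrite [RHS]big_nat_recr ?(ltn_ord i)//= mulrC.
Qed.

Lemma exit_cost_le (R : realType) (r : nat -> R) (N : nat) (A : R) (y : nat) :
  (forall i j, (i <= j < N)%N -> \prod_(i.+1 <= l < j.+1) r l <= A) ->
  (y < N)%N -> exit_cost r y <= 2 * N%:R * A.
Proof.
move=> rA yN; have A1 : 1 <= A.
  by have := rA y y; rewrite leqnn yN big_geq//; apply.
rewrite exit_costE -mulrA ler_pM2l//.
apply: (@le_trans _ _ (\sum_(i < y.+1) A)).
  by apply: ler_sum => i _; apply: rA; rewrite yN andbT -ltnS ltn_ord.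
rewrite sumr_const card_ord -[leLHS]mulr_natl ler_wpM2r ?ler_nat//.
by apply: le_trans A1.
Qed.

(** With [g y] the expected time to reach [N] from [y], the generator maps [g]
to [-1]; dividing by a bound [G] of [g] and adding [1] gives a function that is
comparable to a constant and still decreases at rate [1 / (2 G)]. *)
Lemma lyapunov_function (R : realType) (q r : nat -> R) (N : nat) (A : R) :
  (0 < N)%N -> q 0%N = 0 ->
  (forall y, (0 < y)%N -> 0 <= r y /\ q y = r y * (1 - q y)) ->
  (forall i j, (i <= j < N)%N -> \prod_(i.+1 <= l < j.+1) r l <= A) ->
  exists2 f : nat -> R, (forall y, 1 <= f y <= 2) &
  forall y, (y < N)%N ->
    (1 - q y) * (f y.+1 - f y) + q y * (f y.-1 - f y)
      <= - (4 * N%:R ^+ 2 * A)^-1 * f y.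
Proof.
move=> N0 q0 qr rA.
have A1 : 1 <= A.
  by have := rA 0%N 0%N; rewrite leqnn N0 big_geq//; apply.
have n1 : (1 : R) <= N%:R by rewrite ler1n.
pose D := exit_cost r.
have D2 y : 2 <= D y.
  elim: y => [|y IH] //=; rewrite /D/= lerDl mulr_ge0//.
    by have [] := qr y.+1.
  by apply: le_trans IH.
pose g y := \sum_(y <= z < N) (D z - 1).
(* [G] is kept opaque, so that field and rewriting see it as an atom. *)
have [G GE] : {G | G = 2 * N%:R ^+ 2 * A} by exists (2 * N%:R ^+ 2 * A).
have G0 : 0 < G.
  by rewrite GE !mulr_gt0// ?exprn_gt0 ?ltr0n//; apply: lt_le_trans A1.
have g0 y : 0 <= g y.
  by apply: sumr_ge0 => z _; rewrite subr_ge0; apply: le_trans (D2 z); rewrite ler1n.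
have gG y : g y <= G.
  have [yN|yN] := ltnP y N; last by rewrite /g big_geq// ltW.
  apply: (@le_trans _ _ (\sum_(y <= z < N) (2 * N%:R * A))).
    apply: ler_sum_nat => z /andP[_ zN].
    by have := exit_cost_le rA zN; rewrite /D; lra.
  rewrite sumr_const_nat -[leLHS]mulr_natl GE.
  have -> : 2 * N%:R ^+ 2 * A = N%:R * (2 * N%:R * A) by ring.
  rewrite ler_wpM2r// ?ler_nat ?leq_subr// !mulr_ge0//.
  exact: le_trans A1.
have gS y : (y < N)%N -> g y = D y - 1 + g y.+1.
  by move=> yN; rewrite /g big_ltn.
exists (fun y => 1 + g y / G).
  by move=> y; rewrite lerDl divr_ge0 ?(ltW G0)//= -lerBrDl ler_pdivrMr//
    (_ : 2 - 1 = 1 :> R) ?mul1r ?gG//; lra.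
move=> y yN.
have -> : (4 * N%:R ^+ 2 * A) = 2 * G by rewrite GE; ring.
have Gn : G != 0 by rewrite gt_eqF.
have QG : (1 - q y) * (g y.+1 - g y) + q y * (g y.-1 - g y) = -1.
  case: y yN => [|y] yN; first by rewrite q0 (gS 0%N)//= /D/=; lra.
  have [r0 qE] := qr y.+1 isT.
  rewrite /= (gS y); last exact: ltnW.
  rewrite (gS y.+1)//.
  have -> : D y.+1 = 2 + r y.+1 * D y by [].
  rewrite [X in _ + X * _]qE.
  have : (1 - q y.+1) * (1 + r y.+1) = 1.
    by rewrite mulrDr mulr1 [_ * r _]mulrC -qE subrK.
  move: (1 - q y.+1) (r y.+1) (D y) (g y.+2) => a b c e ab.
  have -> : a * (e - (2 + b * c - 1 + e)) + b * a *
    (c - 1 + (2 + b * c - 1 + e) - (2 + b * c - 1 + e)) = - (a * (1 + b)) by ring.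
  by rewrite ab.
have -> : (1 - q y) * (1 + g y.+1 / G - (1 + g y / G)) +
    q y * (1 + g y.-1 / G - (1 + g y / G)) =
    ((1 - q y) * (g y.+1 - g y) + q y * (g y.-1 - g y)) / G by field.
rewrite QG mulN1r mulNr lerN2.
have gy1 : g y / G <= 1 by rewrite ler_pdivrMr// mul1r.
have Gi : 0 < G^-1 by rewrite invr_gt0.
by rewrite invfM mulrAC -[leRHS]mul1r ler_pM2r//; lra.
Qed.

(** * Decay along a time grid *)

Lemma ler_sum_subrange (R : realType) (F : nat -> R) (a c n : nat) :
  (forall z, 0 <= F z) -> (c <= n)%N ->
  \sum_(a <= z < c) F z <= \sum_(0 <= z < n) F z.
Proof.
move=> F0 cn; have [ca|ac] := leqP c a.
  by rewrite big_geq// sumr_ge0.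
rewrite (big_cat_nat (leq0n a) (leq_trans (ltnW ac) cn))/=.
rewrite (big_cat_nat (ltnW ac) cn)/= addrCA lerDl.
by rewrite addr_ge0// sumr_ge0.
Qed.

Lemma transition_partial_sum_le1 (R : realType) (p : R -> nat -> nat -> R) (h : R)
    (y n : nat) :
  transition_function p -> 0 <= h -> \sum_(0 <= z < n) p h y z <= 1.
Proof.
move=> tp h0; rewrite -lee_fin -(transition_sum1 tp y h0) -sumEFin.
by apply: nneseries_lim_ge => z _; rewrite lee_fin (transition_ge0 tp).
Qed.

(** The values of [f] at the sites other than the neighbours of [y] are
bounded by [2], and these sites carry a mass [o(h)]; at the neighbours the
rates apply. Hence the increment of the mean of [f] over a time [h] is [h]
times the generator, up to [o(h)]. The second bound says that [N] is hardly
ever jumped over. *)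
Lemma one_step_generator (R : realType) (q : nat -> R) (p : R -> nat -> nat -> R)
    (f : nat -> R) (N y : nat) (e : R) :
  transition_function p -> nearest_neighbour_rates q p -> q 0%N = 0 ->
  (forall y, 1 <= f y <= 2) -> 0 < e -> (y < N)%N ->
  \forall h \near (0 : R)^'+,
    \sum_(0 <= z < N) p h y z * f z <=
      f y + h * ((1 - q y) * (f y.+1 - f y) + q y * (f y.-1 - f y)) + e * h
    /\ 1 - \sum_(0 <= z < N.+1) p h y z <= e * h.
Proof.
move=> tp rates q0 f12 e0 yN.
have e8 : 0 < e / 8 by rewrite divr_gt0.
have /eqoP/(_ _ e8) right := nn_right rates y.
have /eqoP/(_ _ e8) other := nn_other rates y.
have left : \forall h \near (0 : R)^'+,
    `|(if y is 0%N then 0 else p h y y.-1) - q y * h| <= e / 8 * `|h|.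
  case: y {yN right other} => [|y].
    near=> h; rewrite q0 mul0r subrr normr0 mulr_ge0// ltW//.
  by have /eqoP/(_ _ e8) := nn_left rates (ltn0Sn y).
near=> h.
have h0 : 0 < h by near: h; exact: nbhs_right_gt.
have p0 z : 0 <= p h y z by apply: (transition_ge0 tp); exact: ltW.
have : `|p h y y.+1 - (1 - q y) * h| <= e / 8 * `|h| by near: h.
have : `|1 - \sum_(y.-1 <= z < y.+2) p h y z| <= e / 8 * `|h| by near: h.
have : `|(if y is 0%N then 0 else p h y y.-1) - q y * h| <= e / 8 * `|h|.
  by near: h.
rewrite (gtr0_norm h0) !ler_norml => /andP[l1 l2] /andP[b1 b2] /andP[r1 r2].
have eh : 0 <= e * h by rewrite mulr_ge0// ltW.
split; last first.
  apply: (@le_trans _ _ (1 - \sum_(y.-1 <= z < y.+2) p h y z)).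
    by rewrite lerD2l lerN2 ler_sum_subrange.
  by apply: le_trans b2 _; lra.
apply: (@le_trans _ _ (\sum_(0 <= z < N.+1) p h y z * f z)).
  rewrite ler_sum_subrange// => z; rewrite mulr_ge0//.
  by have /andP[/(le_trans ler01)] := f12 z.
(* The mass is at most 1, so bounding the mean of [f] from above amounts to
   bounding the mean of [2 - f] from below, and this allows to drop sites. *)
have : \sum_(y.-1 <= z < y.+2) p h y z * (2 - f z) <=
       \sum_(0 <= z < N.+1) p h y z * (2 - f z).
  apply: ler_sum_subrange => // z; rewrite mulr_ge0// subr_ge0.
  by have /andP[] := f12 z.
have sumE a c : \sum_(a <= z < c) p h y z * (2 - f z) =
    2 * (\sum_(a <= z < c) p h y z) - \sum_(a <= z < c) p h y z * f z.
  by rewrite mulr_sumr -sumrB; apply: eq_bigr => z _; rewrite mulrBr [2 * _]mulrC.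
rewrite !sumE.
have := transition_partial_sum_le1 y N.+1 tp (ltW h0).
have /andP[f1 f2] := f12 y; have /andP[fp1 fp2] := f12 y.-1.
have /andP[fs1 fs2] := f12 y.+1.
(* The left neighbour has mass [pl], taken to be 0 when [y = 0]. *)
pose pl := if y is 0%N then 0 else p h y y.-1.
have nbrE F : \sum_(y.-1 <= z < y.+2) p h y z * F z =
    pl * F y.-1 + p h y y * F y + p h y y.+1 * F y.+1.
  rewrite /pl; clear; case: y => [|y] /=.
    by rewrite big_ltn// big_ltn// big_geq// addr0 mul0r add0r.
  by rewrite big_ltn; [|lia]; rewrite big_ltn// big_ltn// big_geq// addr0 addrA.
have := nbrE (fun=> 1); under eq_bigr do rewrite mulr1.
rewrite !mulr1 nbrE; move: b1 b2 l1 l2 r1 r2; rewrite -/pl.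
move: (\sum_(_ <= _ < y.+2) _) (\sum_(_ <= _ < N.+1) p _ _ _) => s S.
move: {nbrE} (\sum_(_ <= _ < N.+1) _) (p h y y.+1) (p h y y) => Sf pr pc.
clearbody pl.
have small k x u : - k <= x -> x <= k -> -1 <= u -> u <= 1 -> x * u <= k :> R.
  by move=> *; nra.
move=> b1 b2 l1 l2 r1 r2 sE S1 Sle.
have k1 : (1 - s) * (2 - f y) <= e / 8 * h.
  by apply: small => //; (clear -f1 f2 fp1 fp2 fs1 fs2; lra).
have k2 : (pl - q y * h) * (f y.-1 - f y) <= e / 8 * h.
  by apply: small => //; (clear -f1 f2 fp1 fp2 fs1 fs2; lra).
have k3 : (pr - (1 - q y) * h) * (f y.+1 - f y) <= e / 8 * h.
  by apply: small => //; (clear -f1 f2 fp1 fp2 fs1 fs2; lra).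
(* The mass at [y] is what the neighbours and the [o(h)] leave. *)
have pcE : pc = s - pl - pr by lra.
by rewrite pcE in Sle; nra.
Unshelve. all: by end_near. Qed.

(** The walk is observed at the [k] times [s + h], [s + 2 h], and so on; the
recursion on the first observation matches the use of the Markov property. *)
Fixpoint avoids (T : Type) (R : realType) (X : R -> T -> nat) (N : nat) (h : R)
    (k : nat) (s : R) : set T :=
  if k is k'.+1 then [set w | X (s + h) w <> N] `&` avoids X N h k' (s + h)
  else setT.

Lemma avoids_measurable d (T : measurableType d) (R : realType)
    (X : R -> T -> nat) (N : nat) (h : R) (k : nat) (s : R) :
  (forall t : R, 0 <= t -> measurable_fun [set: T] (X t)) ->
  0 <= s -> 0 <= h -> measurable (avoids X N h k s).
Proof.
move=> mX s0 h0; elim: k s s0 => [|k IH] s s0 //=.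
have sh0 : 0 <= s + h by rewrite addr_ge0.
apply: measurableI; last exact: IH.
by have := mX _ sh0 measurableT [set z | z <> N] I; rewrite setTI.
Qed.

Definition past_event (T : Type) (R : realType) (X : R -> T -> nat)
    (past : seq (R * nat)) : set T :=
  [set w | forall u, u \in past -> X u.1 w = u.2].

Lemma past_measurable d (T : measurableType d) (R : realType)
    (X : R -> T -> nat) (past : seq (R * nat)) (s : R) :
  (forall t : R, 0 <= t -> measurable_fun [set: T] (X t)) ->
  (forall u, u \in past -> 0 <= u.1 <= s) ->
  measurable (past_event X past).
Proof.
move=> mX; rewrite /past_event; elim: past => [|v past IH] ps.
  by rewrite (_ : mkset _ = setT)//; apply/seteqP; split.
rewrite (_ : mkset _ = [set w | X v.1 w = v.2] `&` past_event X past); last first.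
  apply/seteqP; split=> w /=.
    move=> H; split; first by apply: H; rewrite mem_head.
    by move=> u up; apply: H; rewrite inE up orbT.
  by move=> [H1 H2] u; rewrite inE => /predU1P[->//|]; exact: H2.
apply: measurableI; last by apply: IH => u up; apply: ps; rewrite inE up orbT.
have /andP[v0 _] := ps v (mem_head _ _).
by have := mX _ v0 measurableT [set v.2] I; rewrite setTI.
Qed.

Lemma prob_jump_over d (T : measurableType d) (R : realType)
    (P : probability T R) (Y : T -> nat) (A : set T) (pi : nat -> R) (N : nat) :
  measurable_fun setT Y -> measurable A ->
  (forall z, P (A `&` [set w | Y w = z]) = (P A * (pi z)%:E)%E) ->
  (P (A `&` [set w | (N < Y w)%N]) = P A * (1 - \sum_(0 <= z < N.+1) pi z)%:E)%E.
Proof.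
move=> mY mA piE.
have mz (B : set nat) : measurable (A `&` [set w | B (Y w)]).
  by apply: measurableI => //; have := mY measurableT B I; rewrite setTI.
have /fineK PA : P A \is a fin_num by rewrite fin_num_measure.
have : P A = (P (A `&` [set w | (N < Y w)%N]) +
    P A * (\sum_(0 <= z < N.+1) pi z)%:E)%E.
  pose F z := A `&` [set w | Y w = z].
  have AE : A = (A `&` [set w | (N < Y w)%N]) `|` \big[setU/set0]_(z < N.+1) F z.
    rewrite -bigcup_mkord; apply/seteqP; split=> w; last by case=> [[]|[z _ []]].
    move=> Aw; have [YN|NY] := leqP (Y w) N; last by left.
    by right; exists (Y w).
  rewrite {1}AE measureU//=; last first.
  - apply/seteqP; split=> w //= -[[_ /= NY]].
    rewrite -bigcup_mkord => -[z /= zN [_ Yz]].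
    by move: zN; rewrite -Yz ltnS leqNgt NY.
  - by apply: bigsetU_measurable => z _; exact: (mz [set (z : nat)]).
  - exact: (mz [set z | (N < z)%N]).
  rewrite (@measure_bigsetU _ _ _ P F)//=; last first.
  - apply/trivIsetP => i j _ _ /eqP ij; apply/seteqP; split=> w //=.
    move=> [[_ Yi] [_ Yj]]; by apply: ij; rewrite -Yi -Yj.
  - by move=> z; exact: (mz [set z]).
  rewrite big_mkord; congr (_ + _)%E.
  under eq_bigr do rewrite piE -PA -EFinM.
  by rewrite sumEFin -mulr_sumr EFinM PA.
have /fineK <- : P (A `&` [set w | (N < Y w)%N]) \is a fin_num.
  by rewrite fin_num_measure//; exact: (mz [set z | (N < z)%N]).
rewrite -PA -!EFinM -EFinD => /eqP; rewrite eqe => /eqP AE; congr (_%:E).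
by rewrite mulrBr mulr1 {1}AE; ring.
Qed.

(** Induction on the number of observations, with an arbitrary past: after one
step the walk is at some [z < N], which becomes part of the past, or it has
jumped over [N], which costs [c]. *)
Lemma avoids_prob_le d (T : measurableType d) (R : realType)
    (P : probability T R) (p : R -> nat -> nat -> R) (X : R -> T -> nat)
    (N : nat) (f : nat -> R) (h r c : R) :
  transition_function p -> markov_chain P p X -> (forall y, 1 <= f y) ->
  0 <= h -> 0 <= r -> 0 <= c ->
  (forall y, (y < N)%N ->
    \sum_(0 <= z < N) p h y z * f z <= r * f y /\
    1 - \sum_(0 <= z < N.+1) p h y z <= c) ->
  forall k (past : seq (R * nat)) (s : R) y, 0 <= s ->
    (forall u, u \in past -> 0 <= u.1 <= s) ->
    (y < N)%N ->
    (P (past_event X past `&` [set w | X s w = y]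
        `&` avoids X N h k s) <=
     P (past_event X past `&` [set w | X s w = y])
       * (f y * r ^+ k + k%:R * c)%:E)%E.
Proof.
move=> tp mc f1 h0 r0 c0 step.
have mX := chain_measurable mc.
elim=> [|k IH] past s y s0 ps yN.
  rewrite /= setIT expr0 mulr1 mul0r addr0 -[leLHS]mule1.
  by rewrite lee_wpmul2l// lee_fin.
set A := _ `&` [set w | X s w = y].
have sh0 : 0 <= s + h by rewrite addr_ge0.
have mXsh (B : set nat) : measurable [set w | B (X (s + h) w)].
  by have := mX _ sh0 measurableT B I; rewrite setTI.
have mA : measurable A.
  apply: measurableI; first exact: past_measurable ps.
  by have := mX _ s0 measurableT [set y] I; rewrite setTI.
have /fineK PA : P A \is a fin_num by rewrite fin_num_measure.
have AE z : P (A `&` [set w | X (s + h) w = z]) = (P A * (p h y z)%:E)%E.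
  by rewrite -(chain_markov mc).
have mav : measurable (avoids X N h k (s + h)) by apply: avoids_measurable.
pose F z := A `&` [set w | X (s + h) w = z] `&` avoids X N h k (s + h).
have mF z : measurable (F z).
  by apply: measurableI => //; apply: measurableI => //; exact: (mXsh [set z]).
have mO : measurable (A `&` [set w | (N < X (s + h)%R w)%N]).
  by apply: measurableI => //; exact: (mXsh [set z | (N < z)%N]).
have sub : A `&` avoids X N h k.+1 s `<=`
    \big[setU/set0]_(z < N) F z `|` (A `&` [set w | (N < X (s + h)%R w)%N]).
  rewrite -bigcup_mkord => w [Aw [/= XN av]].
  case: (ltngtP (X (s + h) w) N) => // XN'; last by right.
  by left; exists (X (s + h) w).
have mU : measurable (\big[setU/set0]_(z < N) F z).
  by apply: bigsetU_measurable.
apply: (le_trans (le_measure _ _ _ sub)); rewrite ?inE//.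
- by apply: measurableI => //; apply: measurableI => //; exact: (mXsh [set z | z <> N]).
- exact: measurableU.
apply: (le_trans (measureU2 _ mU mO)).
have [st1 st2] := step y yN.
have jump : (P (A `&` [set w | (N < X (s + h)%R w)%N]) <= P A * c%:E)%E.
  by rewrite (prob_jump_over _ (mX _ sh0) mA AE) lee_wpmul2l// lee_fin.
apply: (@le_trans _ _ (\sum_(z < N) P A * (p h y z * (f z * r ^+ k + k%:R * c))%:E
   + P A * c%:E)%E).
  apply: leeD jump.
  apply: (le_trans (le_mu_bigsetU _ _)) => //.
  apply: lee_sum => z _; rewrite EFinM muleA -AE.
  have AzE : A `&` [set w | X (s + h) w = z] =
    past_event X ((s, y) :: past)
      `&` [set w | X (s + h) w = z].
    apply/seteqP; split => w /= [].
      by move=> [Hp Hs] Hz; split => // u; rewrite inE => /predU1P[->|/Hp].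
    move=> H Hz; split=> //; split; last by apply: (H (s, y)); rewrite mem_head.
    by move=> u up; apply: H; rewrite inE up orbT.
  rewrite /F AzE; apply: IH => // u; rewrite inE => /predU1P[->/=|/ps/andP[-> us]/=].
    by rewrite s0 lerDl.
  by rewrite (le_trans us)// lerDl.
rewrite -PA; under eq_bigr do rewrite -EFinM.
rewrite sumEFin -mulr_sumr -!EFinM -EFinD lee_fin -mulrDr.
rewrite ler_wpM2l ?fine_ge0//.
have S1 := transition_partial_sum_le1 y N tp h0.
rewrite -(big_mkord xpredT (fun z => p h y z * (f z * r ^+ k + k%:R * c))).
under eq_bigr do rewrite mulrDr mulrA.
rewrite big_split/= -!mulr_suml.
apply: (@le_trans _ _ (r * f y * r ^+ k + 1 * (k%:R * c) + c)).
  by rewrite !lerD2r lerD// ler_wpM2r// ?exprn_ge0// mulr_ge0.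
by rewrite exprS -natr1; lra.
Qed.

(** * From the time grid to the hitting time *)

Lemma near_forall_lt (T : Type) (F : set_system T) (Q : nat -> T -> Prop) (n : nat) :
  Filter F -> (forall y, (y < n)%N -> \forall x \near F, Q y x) ->
  \forall x \near F, forall y, (y < n)%N -> Q y x.
Proof.
move=> FF; elim: n => [|n IH] Qn; first by near=> x.
have H1 := IH (fun y yn => Qn y (ltnW yn)).
have H2 := Qn n (ltnSn n).
near=> x; move=> y; rewrite ltnS leq_eqVlt => /predU1P[->|]; first by near: x.
by move: y; near: x.
Unshelve. all: by end_near. Qed.

Lemma avoids_of_never (T : Type) (R : realType) (X : R -> T -> nat) (N : nat)
    (h t : R) (w : T) (k : nat) (s : R) :
  0 < h -> 0 <= s -> s + k%:R * h <= t ->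
  (forall u, 0 < u -> u <= t -> X u w <> N) -> avoids X N h k s w.
Proof.
move=> h0; elim: k s => [//|k IH] s s0 st Xt /=.
have st' : s + h + k%:R * h <= t by move: st; rewrite -natr1; lra.
have kh : 0 <= k%:R * h by rewrite mulr_ge0// ltW.
split; first by apply: Xt; lra.
by apply: IH => //; lra.
Qed.

(** For small [h = t / n], a step multiplies the mean of [f] by at most
[1 + (e - gamma) h] and jumps over [N] with probability at most [e h]; over [n]
steps this gives [2 exp ((e - gamma) t) + e t], and [e] is arbitrary. *)
Lemma survival_le d (T : measurableType d) (R : realType)
    (P : probability T R) (p : R -> nat -> nat -> R) (X : R -> T -> nat)
    (q : nat -> R) (N : nat) (f : nat -> R) (gamma t : R) (A : set T) :
  transition_function p -> nearest_neighbour_rates q p -> markov_chain P p X ->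
  P [set w | X 0 w = 0%N] = 1%E -> q 0%N = 0 -> (0 < N)%N -> 0 < t ->
  (forall y, 1 <= f y <= 2) ->
  (forall y, (y < N)%N ->
    (1 - q y) * (f y.+1 - f y) + q y * (f y.-1 - f y) <= - gamma * f y) ->
  measurable A ->
  A `<=` [set w | forall u, 0 < u -> u <= t -> X u w <> N] ->
  (P A <= (2 * expR (- gamma * t))%:E)%E.
Proof.
move=> tp rates mc X0 q0 N0 t0 f12 Qf mA sA.
have mX0 : measurable [set w | X 0 w = 0%N].
  have mX := chain_measurable mc (lexx 0).
  by have := mX measurableT [set 0%N] I; rewrite setTI.
suff bound e : 0 < e -> (P A <= (2 * expR ((e - gamma) * t) + e * t)%:E)%E.
  have /fineK PA : P A \is a fin_num by rewrite fin_num_measure.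
  rewrite -PA lee_fin.
  have cv : (fun e : R => 2 * expR ((e - gamma) * t) + e * t) @ (0 : R)^'+
      --> 2 * expR ((0 - gamma) * t) + 0 * t.
    apply: cvg_at_right_filter; apply: cvgD; last exact: cvgMl.
    apply: cvgMr; apply: continuous_cvg; first exact: continuous_expR.
    by apply: cvgMl; apply: cvgB => //; exact: cvg_cst.
  have := ler_cvg_to (@cvg_cst _ (fine (P A)) _ _ _) cv.
  rewrite sub0r mul0r addr0; apply; near=> e; rewrite -lee_fin PA.
  by apply: bound; near: e; exact: nbhs_right_gt.
move=> e0.
have : \forall h \near (0 : R)^'+, forall y, (y < N)%N ->
    \sum_(0 <= z < N) p h y z * f z <=
      f y + h * ((1 - q y) * (f y.+1 - f y) + q y * (f y.-1 - f y)) + e * h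
    /\ 1 - \sum_(0 <= z < N.+1) p h y z <= e * h.
  by apply: near_forall_lt => y yN; apply: one_step_generator.
rewrite /at_right near_withinE => /nbhs_ballP[del /= del0 step].
(* Any [n] with [t / n < del] would do. *)
pose n := (Num.truncn (t / del)).+1.
pose h := t / n%:R.
have n0 : (0 : R) < n%:R by rewrite ltr0n.
have h0 : 0 < h by rewrite divr_gt0.
have nh : n%:R * h = t by rewrite /h mulrC divfK// gt_eqF.
have hdel : h < del.
  by rewrite /h ltr_pdivrMr// mulrC -ltr_pdivrMr// truncnS_gt.
clearbody h.
have {}step y : (y < N)%N ->
    \sum_(0 <= z < N) p h y z * f z <= (1 + (e - gamma) * h) * f y /\
    1 - \sum_(0 <= z < N.+1) p h y z <= e * h.
  move=> yN; have [|st1 st2] := step h _ h0 y yN.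
    by rewrite /ball /= sub0r normrN gtr0_norm.
  split=> //; apply: (le_trans st1).
  have /andP[f1 _] := f12 y.
  have := ler_wpM2l (ltW h0) (Qf y yN).
  have : e * h <= e * h * f y by rewrite ler_peMr// mulr_ge0// ltW.
  lra.
have r0 : 0 <= 1 + (e - gamma) * h.
  have /andP[f1 _] := f12 0%N; have [st1 _] := step 0%N N0.
  rewrite -(@pmulr_lge0 _ (f 0%N)) ?(lt_le_trans ltr01)//.
  apply: le_trans st1; apply: sumr_ge0 => z _.
  rewrite mulr_ge0 ?(transition_ge0 tp) ?(ltW h0)//.
  by have /andP[/(le_trans ler01)] := f12 z.
have f1 y : 1 <= f y by have /andP[] := f12 y.
have eh0 : 0 <= e * h by rewrite mulr_ge0 ?(ltW e0) ?(ltW h0).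
have H : (P (past_event X [::] `&` [set w | X 0%R w = 0%N] `&` avoids X N h n 0) <=
    P (past_event X [::] `&` [set w | X 0%R w = 0%N]) *
    (f 0%N * (1 + (e - gamma) * h) ^+ n + n%:R * (e * h))%:E)%E.
  by apply: (avoids_prob_le tp mc f1 (ltW h0) r0 eh0 step).
move: H; have -> : past_event X [::] = setT by apply/seteqP; split.
rewrite setTI X0 mul1e => H.
have mA0 : measurable (avoids X N h n 0).
  by apply: avoids_measurable => //; [exact: chain_measurable mc|exact: ltW].
have -> : P A = P (A `&` [set w | X 0 w = 0%N]).
  have mA' : measurable (A `&` [set w | X 0 w = 0%N]) by exact: measurableI.
  apply/eqP; rewrite eq_le; apply/andP; split; last first.
    by apply: le_measure; rewrite ?inE// => w [].
  apply: (@le_trans _ _ (P ((A `&` [set w | X 0%R w = 0%N]) `|`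
      (A `\` [set w | X 0%R w = 0%N])))); first by rewrite setUIDK.
  apply: (le_trans (measureU2 _ mA' (measurableD mA mX0))).
  rewrite -[leRHS]adde0; apply: leeD => //.
  apply: (@le_trans _ _ (P (~` [set w | X 0%R w = 0%N]))); last first.
    by rewrite probability_setC// X0 subee.
  apply: le_measure; rewrite ?inE//; first exact: measurableD.
  exact: measurableC.
apply: (@le_trans _ _ (P ([set w | X 0 w = 0%N] `&` avoids X N h n 0))).
  apply: le_measure; rewrite ?inE//; try exact: measurableI.
  move=> w [Aw Xw]; split => //; apply: (@avoids_of_never _ _ _ _ _ t) => //.
    by rewrite add0r nh.
  exact: sA.
apply: (le_trans H) => //; rewrite lee_fin [n%:R * _]mulrCA nh; apply: lerD => //.
have /andP[_ f2] := f12 0%N.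
apply: ler_pM => //; [exact: (le_trans ler01)|exact: exprn_ge0|].
rewrite -nh mulrCA expRM_natl.
rewrite lerXn2r// ?nnegrE ?expR_ge0//; exact: expR_ge1Dx.
Unshelve. all: by end_near. Qed.

(** By right continuity an infimum equal to [t] is attained, and a visit to [N]
before [t] is also seen at a rational time; this makes the event measurable. *)
Lemma hitting_time_gtE (T : Type) (R : realType) (X : R -> T -> nat) (N : nat)
    (t : R) :
  (forall w (t : R), 0 <= t -> \forall s \near t^'+, X s w = X t w) -> 0 < t ->
  [set w | (t%:E < hitting_time X N w)%E] =
  [set w | X t w <> N] `&`
    ~` (\bigcup_(r : rat) [set w | 0 < (ratr r : R) < t /\ X (ratr r) w = N]).
Proof.
move=> rc t0; apply/seteqP; split=> w /=.
  move=> tH; have never u : 0 < u -> u <= t -> X u w <> N.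
    move=> u0 ut XuN; move: tH; apply/negP; rewrite -leNgt.
    apply: (@le_trans _ _ u%:E); last by rewrite lee_fin.
    by apply: ereal_inf_lbound; exists u.
  split; first exact: never.
  by move=> [r _ [/andP[r0 rt]]]; exact/never/ltW.
move=> [Xt Xr]; have never u : 0 < u -> u <= t -> X u w <> N.
  move=> u0; rewrite le_eqVlt => /predU1P[->//|ut] XuN.
  have := rc w u (ltW u0); rewrite /at_right near_withinE => /nbhs_ballP[e /= e0].
  move=> near_u; have : u < Num.min t (u + e) by rewrite lt_min ut ltrDl.
  move=> /rat_in_itvoo[r]; rewrite in_itv/= lt_min => /andP[ur /andP[rt re]].
  apply: Xr; exists r => //=; rewrite rt (lt_trans u0 ur); split=> //.
  rewrite near_u// /ball/= distrC gtr0_norm ?subr_gt0// ltrBlDr.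
  by rewrite addrC.
have := rc w t (ltW t0); rewrite /at_right near_withinE => /nbhs_ballP[e /= e0].
move=> near_t; apply: (@lt_le_trans _ _ (t + e)%:E); first by rewrite lte_fin ltrDl.
apply: le_ereal_inf_tmp => _ /= [u [u0 Xu] <-]; rewrite lee_fin leNgt.
apply/negP => ute; have [ut|tu] := leP u t; first exact: never Xu.
apply: Xt; rewrite -Xu; apply/esym/near_t => //.
by rewrite /ball/= distrC gtr0_norm ?subr_gt0// ltrBlDr addrC.
Qed.

(** The increment of the potential from [i] to [j]. *)
Definition climb (R : realType) (b alpha : R) (om : nat -> R) (i j : nat) : R :=
  \sum_(i.+1 <= l < j.+1) (om l - b * l%:R `^ (- alpha)).

(** The product of the odds of a jump to the left over an interval is the
exponential of a climb, so [lyapunov_function] applies with [A = e^M]. *)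
Lemma quenched_tail d (T : measurableType d) (R : realType) (b alpha : R)
    (om : nat -> R) (P : probability T R) (X : R -> T -> nat) (N : nat) (t M : R) :
  quenched_walk b alpha om P X -> (0 < N)%N -> 0 < t ->
  (forall i j, (i <= j < N)%N ->
    climb b alpha om i j <= M) ->
  (P [set w | t%:E < hitting_time X N w]
     <= (2 * expR (- (4 * N%:R ^+ 2 * expR M)^-1 * t))%:E)%E.
Proof.
move=> [X0 [p [tp rates mc]]] N0 t0 VM.
pose r l := expR (om l - b * l%:R `^ (- alpha)).
have [] := @lyapunov_function R (jump_left b alpha om) r N (expR M) N0.
- by [].
- move=> [//|y] _; rewrite /jump_left /=.
  rewrite (_ : expR _ = r y.+1)//; have r0 : 0 < r y.+1 by exact: expR_gt0.
  have r1 : 0 < 1 + r y.+1 by rewrite addr_gt0.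
  split; first exact: ltW.
  by field; rewrite gt_eqF.
- by move=> i j ij; rewrite /r -expR_sum ler_expR; exact: VM.
move=> f f12 Qf.
have mX := chain_measurable mc; have rc := chain_right_continuous mc.
have mXB u (B : set nat) : 0 <= u -> measurable [set w | B (X u w)].
  by move=> /mX/(_ measurableT B I); rewrite setTI.
apply: (survival_le tp rates mc X0 _ N0 t0 f12 Qf) => //.
  rewrite hitting_time_gtE//; apply: measurableI.
    exact: (mXB _ [set z | z <> N] (ltW t0)).
  apply: measurableC; apply: bigcupT_measurable_rat => s.
  have [/andP[s0 st]|/negP nst] := boolP (0 < (ratr s : R) < t).
    rewrite (_ : mkset _ = [set w | [set N] (X (ratr s) w)]).
      exact/mXB/ltW.
    by apply/seteqP; split => w /= => [[]|] // XN; rewrite s0 st.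
  by rewrite (_ : mkset _ = set0)//; apply/seteqP; split => w /= // [].
move=> w /= tH u u0 ut XuN; move: tH; apply/negP; rewrite -leNgt.
apply: (@le_trans _ _ u%:E); last by rewrite lee_fin.
by apply: ereal_inf_lbound; exists u.
Qed.

(** * Integrals of products of independent variables *)

(** The values of [g] are nonnegative; writing [`|k|] for a value [k] makes
each term of the sum nonnegative without a side condition on [k]. *)
Lemma integral_mul_comp_nnsfun d (T : measurableType d) (R : realType)
    (P : probability T R) (X : {RV P >-> R}) (Z : T -> R) (c : R)
    (g : {nnsfun R >-> R}) :
  measurable_fun setT Z -> (forall x, 0 <= Z x) ->
  (forall B, measurable B ->
    (\int[P]_x (Z x * \1_(X @^-1` B) x)%:E = c%:E * P (X @^-1` B))%E) ->
  (\int[P]_x (Z x * g (X x))%:E =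
   \sum_(k \in range g) (`|k| * c)%:E * P (X @^-1` (g @^-1` [set k])))%E.
Proof.
move=> mZ Z0 ZX.
have mXB B : measurable B -> measurable (X @^-1` B).
  by move=> mB; rewrite -[_ @^-1` _]setTI; exact: measurable_funP.
have gE x : g x = \sum_(k \in range g) `|k| * \1_(g @^-1` [set k]) x.
  rewrite fimfunE; apply: eq_fsbigr => k; rewrite inE => -[y _ <-].
  by rewrite ger0_norm.
transitivity (\int[P]_x (\sum_(k \in range g)
    (`|k| * (Z x * \1_(X @^-1` (g @^-1` [set k])) x))%:E)%E)%E.
  apply: eq_integral => x _; rewrite fsumEFin// gE mulr_fsumr//.
  congr (_%:E); apply: eq_fsbigr => k _; rewrite mulrCA; congr (_ * (_ * _)).
have mZk k : measurable_fun setT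
    ((fun x => (Z x * \1_(X @^-1` (g @^-1` [set k])) x)%:E) : T -> \bar R).
  apply/measurable_EFinP; apply: measurable_funM => //.
  exact/measurable_indic/mXB.
have Zk0 k x : (0 <= (Z x * \1_(X @^-1` (g @^-1` [set k])) x)%:E)%E.
  by rewrite lee_fin mulr_ge0.
rewrite ge0_integral_fsum//.
- apply: eq_fsbigr => k _.
  under eq_integral do rewrite EFinM.
  rewrite ge0_integralZl_EFin// ZX//; first by rewrite EFinM muleA.
- by move=> k; under eq_fun do rewrite EFinM; exact: measurable_funeM.
- by move=> k x _; rewrite EFinM mule_ge0// lee_fin.
Qed.

(** If [Z] is independent of the events [X \in B], in the sense of the
hypothesis, then it is so of all [f (X)]: by linearity for simple functions, and
by monotone convergence in general. *)
Lemma integral_mul_comp d (T : measurableType d) (R : realType)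
    (P : probability T R) (X : {RV P >-> R}) (Z : T -> R) (c : R) (f : R -> R) :
  measurable_fun setT Z -> (forall x, 0 <= Z x) ->
  (forall B, measurable B ->
    (\int[P]_x (Z x * \1_(X @^-1` B) x)%:E = c%:E * P (X @^-1` B))%E) ->
  measurable_fun setT f -> (forall x, 0 <= f x) ->
  (\int[P]_x (Z x * f (X x))%:E = c%:E * \int[P]_x (f (X x))%:E)%E.
Proof.
move=> mZ Z0 ZX mf f0.
have mXB B : measurable B -> measurable (X @^-1` B).
  by move=> mB; rewrite -[_ @^-1` _]setTI; exact: measurable_funP.
have mEf : measurable_fun setT ((fun x => (f x)%:E) : R -> \bar R).
  exact/measurable_EFinP.
pose g := nnsfun_approx measurableT mEf.
have limg (Y : T -> R) : measurable_fun setT Y -> (forall x, 0 <= Y x) ->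
    (\int[P]_x (Y x * g n (X x))%:E)%E @[n --> \oo] -->
    (\int[P]_x (Y x * f (X x))%:E)%E.
  move=> mY Y0.
  have -> : (\int[P]_x (Y x * f (X x))%:E)%E =
      (\int[P]_x (limn (fun n => (Y x * g n (X x))%:E)))%E.
    apply: eq_integral => x _; apply/esym/cvg_lim => //.
    under eq_fun do rewrite EFinM; rewrite EFinM.
    apply: cvgeZl => //.
    by apply: (@cvg_nnsfun_approx _ _ _ _ measurableT _ mEf) => // y _; rewrite lee_fin.
  apply: cvg_monotone_convergence => //.
  - move=> n; apply/measurable_EFinP; apply: measurable_funM => //.
    exact: measurableT_comp.
  - by move=> n x _; rewrite lee_fin mulr_ge0.
  - move=> x _ m n mn; rewrite lee_fin ler_wpM2l//.
    exact/lefP/nd_nnsfun_approx.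
have lim1 := limg (cst 1) (measurable_cst _) (fun=> ler01).
have limZ := limg Z mZ Z0.
have ZE n : (\int[P]_x (Z x * g n (X x))%:E =
    c%:E * \int[P]_x (cst 1 x * g n (X x))%:E)%E.
  rewrite (integral_mul_comp_nnsfun (g n) mZ Z0 ZX).
  rewrite (@integral_mul_comp_nnsfun _ _ _ _ X (cst 1) 1 (g n))//; last first.
    move=> B mB; under eq_integral do rewrite mul1r.
    by rewrite integral_indic ?setIT ?mul1e//; exact: mXB.
  rewrite ge0_mule_fsumr//.
    apply: eq_fsbigr => k _; rewrite mulr1 muleA; congr (_ * _)%E.
    by rewrite -EFinM mulrC.
  by move=> k; rewrite mulr1 mule_ge0// lee_fin.
have -> : (\int[P]_x (f (X x))%:E = \int[P]_x (cst 1 x * f (X x))%:E)%E.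
  by apply: eq_integral => x _; rewrite mul1r.
have limc : (c%:E * \int[P]_x (cst 1 x * g n (X x))%:E)%E @[n --> \oo] -->
    (c%:E * \int[P]_x (cst 1 x * f (X x))%:E)%E by exact: cvgeZl.
by apply: cvg_unique limZ _ => //; rewrite (funext ZE).
Qed.

(** Independence is given for events. The indicators are replaced one at a time
by [f]: the induction is on the number of factors that are already of the form
[f (omega i)], the other ones being the indicators of arbitrary events. *)
Lemma independent_integral_prod d (T : measurableType d) (R : realType)
    (P : probability T R) (D : set nat) (omega : nat -> {RV P >-> R})
    (f : R -> R) (m : R) (s : seq nat) :
  independent_on D omega -> uniq s -> (forall i, i \in s -> D i) ->
  measurable_fun setT f -> (forall x, 0 <= f x) ->
  (forall i, D i -> \int[P]_x (f (omega i x))%:E = m%:E)%E ->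
  (\int[P]_x (\prod_(i <- s) f (omega i x))%:E = (m ^+ size s)%:E)%E.
Proof.
move=> indep us sD mf f0 fm.
have mXB i B : measurable B -> measurable (omega i @^-1` B).
  by move=> mB; rewrite -[_ @^-1` _]setTI; exact: measurable_funP.
pose G s2 (B : nat -> set R) := \big[setI/setT]_(i <- s2) (omega i @^-1` B i).
have mG s2 B : (forall i, measurable (B i)) -> measurable (G s2 B).
  by move=> mB; apply: bigsetI_measurable => i _; exact: mXB.
suff claim s1 s2 B : uniq (s1 ++ s2) -> (forall i, i \in s1 ++ s2 -> D i) ->
    (forall i, measurable (B i)) ->
    (\int[P]_x ((\prod_(i <- s1) f (omega i x)) * \1_(G s2 B) x)%:E
      = (m ^+ size s1)%:E * P (G s2 B))%E.
  have := claim s [::] (fun=> setT); rewrite cats0 => /(_ us sD).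
  move=> /(_ (fun=> measurableT)); rewrite /G big_nil probability_setT mule1.
  by move=> <-; apply: eq_integral => x _; rewrite indicE in_setT mulr1.
elim: s1 s2 B => [|i s1 IH] s2 B us12 s12D mB.
  under eq_integral do rewrite big_nil mul1r.
  by rewrite expr0 mul1e integral_indic ?setIT//; exact: mG.
move: us12; rewrite /= mem_cat negb_or => /andP[/andP[is1 is2] us12].
have Di : D i by apply: s12D; rewrite mem_head.
have us2 : uniq s2 by move: us12; rewrite cat_uniq => /and3P[].
have s2D j : j \in s2 -> D j.
  by move=> js; apply: s12D; rewrite inE mem_cat js !orbT.
pose Z x := (\prod_(j <- s1) f (omega j x)) * \1_(G s2 B) x.
have mZ : measurable_fun setT Z.
  apply: measurable_funM; last exact/measurable_indic/mG.
  apply: measurable_prod => j _; exact: measurableT_comp.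
have Z0 x : 0 <= Z x by rewrite mulr_ge0// prodr_ge0.
have /fineK PG : P (G s2 B) \is a fin_num by rewrite fin_num_measure//; exact: mG.
transitivity (\int[P]_x (Z x * f (omega i x))%:E)%E.
  by apply: eq_integral => x _; rewrite big_cons -mulrA mulrC.
rewrite (@integral_mul_comp _ _ _ _ (omega i) Z (m ^+ size s1 * fine (P (G s2 B))))//.
  by rewrite fm// -PG -!EFinM exprS/= mulrAC [m * _]mulrC.
move=> B0 mB0; pose B' j := if j == i then B0 else B j.
have mB' j : measurable (B' j) by rewrite /B'; case: eqP.
have B's2 : G s2 B' = G s2 B.
  apply: eq_big_seq => j js; rewrite /B'; case: eqP => // ji.
  by rewrite -ji js in is2.
have GE : G (i :: s2) B' = omega i @^-1` B0 `&` G s2 B.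
  by rewrite -B's2 /G big_cons {1}/B' eqxx.
have PGE : P (G (i :: s2) B') = (P (omega i @^-1` B0) * P (G s2 B))%E.
  rewrite -B's2 {1}/G indep//=.
  - by rewrite big_cons {1}/B' eqxx indep.
  - by rewrite is2.
  - by move=> j; rewrite inE => /predU1P[->|/s2D].
transitivity (\int[P]_x
    ((\prod_(j <- s1) f (omega j x)) * \1_(G (i :: s2) B') x)%:E)%E.
  apply: eq_integral => x _; rewrite GE /Z -mulrA; congr (_ * _)%:E.
  by rewrite indicI/= mulrC.
rewrite IH//.
- by rewrite PGE EFinM PG [(P (_ @^-1` _) * _)%E]muleC muleA.
- by rewrite -[i :: s2]cat1s uniq_catCA /= mem_cat negb_or is1 is2.
- by move=> j; rewrite mem_cat inE => /or3P[js|/eqP->//|js]; apply: s12D;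
    rewrite inE mem_cat js ?orbT.
Qed.

(** * Moment generating functions *)

(** Factor [y^3] out of the tail of the exponential series and use
[(i + 3)! >= i!]. *)
Lemma expR_le_taylor2 (R : realType) (y : R) :
  expR y <= 1 + y + y ^+ 2 / 2 + `|y| ^+ 3 * expR `|y|.
Proof.
have lim_expR (x : R) : limn (series (exp_coeff x)) = expR x by [].
rewrite -{1}lim_expR; apply: limr_le; first exact: is_cvg_series_exp_coeff.
near=> n; have n3 : (3 <= n)%N by near: n; exists 3%N.
rewrite -(subnK n3) addnC; move: (n - 3)%N => {n3}m.
rewrite /series/= (big_cat_nat (leq0n 3) (leq_addr m 3))/=.
apply: lerD.
  rewrite big_ltn// big_ltn// big_ltn// big_geq// addr0 !exp_coeffE /=.
  by rewrite expr0 expr1 fact0 invr1 !mul1r addrA mulrC.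
have -> : \sum_(3 <= i < 3 + m) exp_coeff y i = \sum_(0 <= i < m) exp_coeff y (i + 3).
  by rewrite -{1}[3%N]add0n big_addn addKn.
apply: (@le_trans _ _ (`|y| ^+ 3 * \sum_(0 <= i < m) exp_coeff `|y| i)).
  rewrite mulr_sumr; apply: ler_sum => i _; rewrite !exp_coeffE/=.
  rewrite mulrCA -exprD addnC -normrX; apply: (le_trans (ler_norm _)).
  rewrite normrM ler_wpM2r// ger0_norm// lef_pV2 ?posrE ?ltr0n ?fact_gt0//.
  by rewrite ler_nat; apply: leq_fact; lia.
rewrite ler_wpM2l ?exprn_ge0// -lim_expR.
apply: (@nondecreasing_cvgn_le _ (series (exp_coeff `|y|))).
  by apply: nondecreasing_series => i _ _; exact: exp_coeff_ge0.
exact: is_cvg_series_exp_coeff.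
Unshelve. all: by end_near. Qed.

(** The second order Taylor expansion of the moment generating function at [0].
The remainder [|theta X|^3 exp |theta X|] is dominated by [theta^3] times an
integrable variable, and this is absorbed by [v - s] for small [theta]. *)
Lemma mgf_le d (T : measurableType d) (R : realType) (P : probability T R)
    (X : {RV P >-> R}) (s v theta0 : R) :
  ('E_P[X] = 0)%E -> ('E_P[(fun w => X w ^+ 2)%R] = s%:E)%E ->
  0 < theta0 ->
  (forall theta : R, `|theta| < theta0 ->
     ('E_P[(fun w => expR (theta * X w))%R] < +oo)%E) ->
  s < v ->
  exists2 theta1 : R, 0 < theta1 & forall theta, 0 <= theta <= theta1 ->
    exists2 m : R, 0 <= m <= expR (theta ^+ 2 * v / 2) &
      (\int[P]_x (expR (theta * X x))%:E = m%:E)%E.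
Proof.
have EE (f : T -> R) : ('E_P[f] = \int[P]_w (f w)%:E)%E by rewrite unlock.
rewrite !EE => EX EX2 th0 mgf sv.
pose r := theta0 / 2.
have r0 : 0 < r by rewrite divr_gt0.
have mX : measurable_fun setT X by exact: measurable_funP.
have iexp theta : `|theta| < theta0 ->
    P.-integrable setT (EFin \o (fun x => expR (theta * X x))).
  move=> /mgf; rewrite EE => fin; apply/integrableP; split.
    by apply/measurable_EFinP; apply: measurableT_comp => //; exact: measurable_funM.
  rewrite (eq_integral (fun x => (expR (theta * X x))%:E))// => x _ /=.
  by rewrite ger0_norm ?expR_ge0.
(* [W] bounds [exp (r |X|)], and [r < theta0] leaves it integrable. *)
pose W x := expR (r * X x) + expR (- r * X x).
have iW : P.-integrable setT (EFin \o W).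
  rewrite (_ : EFin \o W = (EFin \o (fun x => expR (r * X x))) \+
    (EFin \o (fun x => expR (- r * X x))))%E; last first.
    by apply/funext => x /=; rewrite EFinD.
  by apply: integrableD => //; apply: iexp; rewrite ?normrN gtr0_norm// /r; lra.
have expW x : expR (r * `|X x|) <= W x.
  by rewrite /W; case: (ger0P (X x)) => _; rewrite ?mulrN -?mulNr ?lerDl ?lerDr ?expR_ge0.
have iX : P.-integrable setT (EFin \o X).
  apply: (@le_integrable _ _ _ _ _ _ _ (EFin \o (fun x => r^-1 * W x))) => //.
  - exact/measurable_EFinP.
  - move=> x _ /=; rewrite lee_fin [leRHS]ger0_norm; last first.
      by rewrite mulr_ge0 ?invr_ge0 ?(ltW r0)// addr_ge0 ?expR_ge0.
    rewrite -ler_pdivrMl ?invr_gt0// invrK.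
    by apply: le_trans (expW x); apply: le_trans (expR_ge1Dx _); rewrite lerDr.
  rewrite (_ : _ \o _ = fun x => (r^-1%:E * (EFin \o W) x)%E); last first.
    by apply/funext => x /=; rewrite EFinM.
  exact: integrableZl.
have iX2 : P.-integrable setT (EFin \o (fun x => X x ^+ 2)).
  apply/integrableP; split.
    by apply/measurable_EFinP; exact: measurable_funX.
  rewrite (eq_integral (fun x => (X x ^+ 2)%:E)); last first.
    by move=> x _ /=; rewrite ger0_norm// sqr_ge0.
  by rewrite EX2 ltry.
pose C := fine (\int[P]_x (W x)%:E).
have C0 : 0 <= C.
  by apply: fine_ge0; apply: integral_ge0 => x _; rewrite lee_fin addr_ge0 ?expR_ge0.
have [a a0 ar] : exists2 a, 0 < a & a = r / 2 by exists (r / 2); rewrite ?divr_gt0.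
(* Half of [r] pays for [|X|^3 <= K exp (a |X|)], the other half for
   [exp |theta X|]. *)
pose K := 6 / a ^+ 3.
have K0 : 0 <= K by rewrite divr_ge0// exprn_ge0// ltW.
pose th1 := Num.min a ((v - s) / (2 * (K * C + 1))).
have KC1 : 0 < K * C + 1 by rewrite addrC ltr_pwDl// mulr_ge0.
exists th1.
  by rewrite lt_min a0/= divr_gt0 ?subr_gt0// mulr_gt0.
move=> th /andP[t0]; rewrite le_min => /andP[tr tvs].
have ith : P.-integrable setT (EFin \o (fun x => expR (th * X x))).
  by apply: iexp; rewrite ger0_norm//; rewrite ar /r in tr; lra.
have point x : expR (th * X x) <= 1 + (th * X x + (th ^+ 2 / 2 * (X x ^+ 2)
    + th ^+ 3 * K * W x)).
  apply: (le_trans (expR_le_taylor2 _)); rewrite !addrA.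
  rewrite exprMn [_ * _ / 2]mulrAC lerD2l normrM (ger0_norm t0).
  rewrite exprMn -[leLHS]mulrA -[leRHS]mulrA ler_wpM2l ?exprn_ge0//.
  apply: (@le_trans _ _ (K * expR (a * `|X x|) * expR (th * `|X x|))).
    rewrite ler_wpM2r ?expR_ge0// /K mulrAC ler_pdivlMr ?exprn_gt0//.
    rewrite -exprMn mulrC -ler_pdivrMl// mulrC [`|X x| * a]mulrC.
    have x0 : 0 <= a * `|X x| by rewrite mulr_ge0// ltW.
    by have := expR_ge1Dxn 2 x0; rewrite -[2.+1`!]/6%N; lra.
  rewrite -mulrA ler_wpM2l// -expRD; apply: le_trans (expW x).
  by rewrite ler_expR -mulrDl ler_wpM2r//; rewrite ar in tr *; lra.
have i1 : P.-integrable setT (EFin \o (cst 1 : T -> R)).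
  exact: finite_measure_integrable_cst.
have iZ (k : R) (f : T -> R) : P.-integrable setT (EFin \o f) ->
    P.-integrable setT (EFin \o (fun x => k * f x)).
  move=> fi; rewrite (_ : _ \o _ = fun x => (k%:E * (EFin \o f) x)%E); last first.
    by apply/funext => x /=; rewrite EFinM.
  exact: integrableZl.
have iD (f g : T -> R) : P.-integrable setT (EFin \o f) ->
    P.-integrable setT (EFin \o g) ->
    P.-integrable setT (EFin \o (fun x => f x + g x)).
  move=> fi gi; rewrite (_ : _ \o _ = ((EFin \o f) \+ (EFin \o g))%E); last first.
    by apply/funext => x /=; rewrite EFinD.
  exact: integrableD.
exists (Rintegral P setT (fun x => expR (th * X x))); last first.
  rewrite /Rintegral fineK//; exact: (integrable_fin_num measurableT ith).
apply/andP; split; first by apply: Rintegral_ge0 => x _; exact: expR_ge0.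
apply: (@le_trans _ _ (1 + (th * 0 + (th ^+ 2 / 2 * s + th ^+ 3 * K * C)))).
  have := @le_Rintegral _ _ _ P setT _ _ measurableT ith _ (fun x _ => point x).
  have iA := iD _ _ (iZ (th ^+ 2 / 2) _ iX2) (iZ (th ^+ 3 * K) _ iW).
  have iB := iD _ _ (iZ th _ iX) iA.
  rewrite RintegralD// ?RintegralD//; try by [exact: iZ|exact: i1].
  have -> : Rintegral P setT (fun=> 1) = 1.
    by rewrite Rintegral_cst// mul1r [X in fine X]probability_setT.
  rewrite !RintegralZl//.
  rewrite /Rintegral EX EX2; apply; exact: (iD _ _ i1 iB).
apply: le_trans (expR_ge1Dx _); rewrite lerD2l mulr0 add0r.
have : th * (K * C) <= (v - s) / 2.
  apply: (@le_trans _ _ (th * (K * C + 1))); first by rewrite ler_wpM2l// lerDl.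
  by rewrite -ler_pdivlMr// (le_trans tvs)// invfM mulrA.
move=> /(ler_wpM2l (sqr_ge0 th)); rewrite exprS; lra.
Qed.

(** * Climbs of the potential between the points of a grid *)

Lemma partial_sum_mgf_le d (T : measurableType d) (R : realType)
    (P : probability T R) (omega : nat -> {RV P >-> R}) (theta m c : R) (i n : nat) :
  iid_environment omega -> 0 <= m <= expR c ->
  (\int[P]_x (expR (theta * omega 1%N x))%:E = m%:E)%E ->
  (\int[P]_x (expR (theta * \sum_(i.+1 <= l < (i + n).+1) omega l x))%:E
    <= (expR (n%:R * c))%:E)%E.
Proof.
move=> [indep law] /andP[m0 mc] Em.
pose f (r : R) := expR (theta * r).
have mf : measurable_fun setT f.
  by apply: measurableT_comp => //; exact: measurable_funM.
have f0 r : 0 <= f r by exact: expR_ge0.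
have fm l : (1 <= l)%N -> (\int[P]_x (f (omega l x))%:E = m%:E)%E.
  move=> l1; rewrite -Em.
  have mEf : measurable_fun setT (fun r : R => (f r)%:E) by exact/measurable_EFinP.
  have dist k : (\int[P]_x (f (omega k x))%:E =
      \int[distribution P (omega k)]_y (f y)%:E)%E.
    by rewrite ge0_integral_distribution// => y; rewrite lee_fin.
  rewrite dist [RHS](dist 1%N); apply: eq_measure_integral => A mA _.
  exact: law.
have iotaD l : l \in index_iota i.+1 (i + n).+1 -> (1 <= l)%N.
  by rewrite mem_index_iota => /andP[/(leq_trans _)->].
have := independent_integral_prod indep (iota_uniq _ _) iotaD mf f0 fm.
rewrite size_iota subSS addKn => E.
apply: (@le_trans _ _ (m ^+ n)%:E).
  rewrite -E le_eqVlt; apply/orP; left; apply/eqP; apply: eq_integral => x _.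
  by rewrite mulr_sumr expR_sum /index_iota subSS addKn.
by rewrite lee_fin expRM_natl lerXn2r// ?nnegrE// expR_ge0.
Qed.

(** Going from [i] to the next multiple of [L], then to the last multiple of [L]
before [j], then to [j] costs at most [h'], [h] and [h']. The drift may be
dropped in the first and last pieces because it points downwards. *)
Lemma climb_le_on_grid (R : realType) (b alpha : R) (om : nat -> R) (N L : nat)
    (dr h h' : R) :
  (0 < L)%N -> 0 <= dr -> 0 <= h -> 0 <= h' ->
  (forall l, (1 <= l <= N)%N -> dr <= b * l%:R `^ (- alpha)) ->
  (forall p m, (p * L + m * L <= N)%N ->
    \sum_((p * L).+1 <= l < (p * L + m * L).+1) om l - (m * L)%:R * dr <= h) ->
  (forall i m, (m <= L)%N -> (i + m <= N)%N ->
    \sum_(i.+1 <= l < (i + m).+1) om l <= h') ->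
  forall i j, (i <= j <= N)%N -> climb b alpha om i j <= h + 2 * h'.
Proof.
move=> L0 dr0 h0 h'0 drift grid short.
have climbS i j : (i <= j <= N)%N ->
    climb b alpha om i j <= \sum_(i.+1 <= l < j.+1) om l - (j - i)%:R * dr.
  move=> /andP[ij jN]; rewrite /climb sumrB lerD2l lerN2.
  rewrite -subSS mulr_natl -sumr_const_nat; apply: ler_sum_nat => l /andP[il lj].
  by rewrite drift//; lia.
have climb_short i j : (i <= j <= N)%N -> (j - i <= L)%N ->
    climb b alpha om i j <= h'.
  move=> ijN jiL; apply: (le_trans (climbS _ _ ijN)); have /andP[ij jN] := ijN.
  apply: (@le_trans _ _ (\sum_(i.+1 <= l < j.+1) om l)).
    by rewrite gerBl mulr_ge0.
  by have := short i (j - i)%N jiL; rewrite subnKC//; apply.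
have climbD i j k : (i <= j <= k)%N ->
    climb b alpha om i k = climb b alpha om i j + climb b alpha om j k.
  by move=> /andP[ij jk]; rewrite /climb (big_cat_nat (n := j.+1)).
move=> i j /andP[ij jN].
pose p := ((i + L.-1) %/ L)%N; pose q := (j %/ L)%N.
have ip : (i <= p * L)%N.
  by have := ltn_ceil (i + L.-1) L0; rewrite -/p mulSn; lia.
have pi : (p * L - i <= L)%N by have := leq_trunc_div (i + L.-1) L; rewrite -/p; lia.
have qj : (q * L <= j)%N by have := leq_trunc_div j L.
have jq : (j - q * L <= L)%N by have := ltn_ceil j L0; rewrite -/q mulSn; lia.
have [pq|qp] := leqP p q; last first.
  have qpL : (q * L + L <= p * L)%N by rewrite -mulSnr leq_mul2r qp orbT.
  apply: (@le_trans _ _ h'); last by lra.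
  apply: climb_short; [by rewrite ij|].
  by move: pi jq qpL; move: (p * L)%N (q * L)%N => pL qL; lia.
have pqL : (p * L <= q * L)%N by rewrite leq_mul2r pq orbT.
rewrite (climbD i (p * L)%N j); last by rewrite ip (leq_trans pqL).
rewrite (climbD (p * L)%N (q * L)%N j); last by rewrite pqL.
have c1 : climb b alpha om i (p * L) <= h'.
  by apply: climb_short => //; rewrite ip (leq_trans pqL)// (leq_trans qj).
have c3 : climb b alpha om (q * L) j <= h' by apply: climb_short => //; rewrite qj.
have c2 : climb b alpha om (p * L) (q * L) <= h.
  apply: (le_trans (climbS _ _ _)); first by rewrite pqL (leq_trans qj).
  have -> : (q * L = p * L + (q - p) * L)%N by rewrite -mulnDl subnKC.
  rewrite addKn; apply: grid.
  by rewrite -mulnDl subnKC// (leq_trans qj).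
lra.
Qed.

(** This and the next sum are Chernoff bounds in integrated form: a sum of
exponentials below [1] has all its exponents negative, so that the smallness of
its mean does the work of a union bound. *)
Definition grid_weight (R : realType) (om : nat -> R) (theta dr h : R) (N L : nat) : R :=
  \sum_(0 <= p < (N %/ L).+1) \sum_(0 <= m < (N %/ L).+1)
    expR (theta * (\sum_((p * L).+1 <= l < (p * L + m * L).+1) om l
                   - (m * L)%:R * dr - h)).

Definition short_weight (R : realType) (om : nat -> R) (theta h : R) (N L : nat) : R :=
  \sum_(0 <= i < N.+1) \sum_(0 <= m < L.+1)
    expR (theta * (\sum_(i.+1 <= l < (i + m).+1) om l - h)).

Lemma ler_sum2_term (R : realType) (F : nat -> nat -> R) (a c i j : nat) :
  (forall i j, 0 <= F i j) -> (i < a)%N -> (j < c)%N ->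
  F i j <= \sum_(0 <= i < a) \sum_(0 <= j < c) F i j.
Proof.
move=> F0 ia jc; rewrite big_mkord (bigD1 (Ordinal ia))//= big_mkord.
rewrite (bigD1 (Ordinal jc))//= -addrA lerDl addr_ge0 ?sumr_ge0// => k _.
exact: sumr_ge0.
Qed.

Lemma climb_le_of_weight (R : realType) (b alpha : R) (om : nat -> R) (N L : nat)
    (theta theta' dr h h' : R) :
  (0 < L)%N -> 0 <= dr -> 0 <= h -> 0 <= h' -> 0 < theta -> 0 < theta' ->
  (forall l, (1 <= l <= N)%N -> dr <= b * l%:R `^ (- alpha)) ->
  grid_weight om theta dr h N L + short_weight om theta' h' N L < 1 ->
  forall i j, (i <= j <= N)%N -> climb b alpha om i j <= h + 2 * h'.
Proof.
move=> L0 dr0 h0 h'0 t0 t'0 drift W1.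
have gw0 : 0 <= grid_weight om theta dr h N L.
  by do 2 (apply: sumr_ge0 => ? _); exact: expR_ge0.
have sw0 : 0 <= short_weight om theta' h' N L.
  by do 2 (apply: sumr_ge0 => ? _); exact: expR_ge0.
have expR1 (t y : R) : 0 < t -> expR (t * y) < 1 -> y <= 0.
  by move=> tp; rewrite -expR0 ltr_expR pmulr_rlt0// => /ltW.
apply: (@climb_le_on_grid _ _ _ _ N L dr) => //.
  move=> p m pmN; have pm : (p + m <= N %/ L)%N by rewrite leq_divRL// mulnDl.
  rewrite -subr_le0; apply: (expR1 _ _ t0); apply: le_lt_trans W1.
  apply: (@le_trans _ _ (grid_weight om theta dr h N L)); last by rewrite lerDl.
  apply: (ler_sum2_term (F := fun p m => expR (theta * (\sum_((p * L).+1 <= l <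
    (p * L + m * L).+1) om l - (m * L)%:R * dr - h)))) => [? ?||].
  - exact: expR_ge0.
  - by rewrite ltnS (leq_trans (leq_addr _ _) pm).
  - by rewrite ltnS (leq_trans (leq_addl _ _) pm).
move=> i m mL imN; rewrite -subr_le0; apply: (expR1 _ _ t'0).
apply: le_lt_trans W1.
apply: (@le_trans _ _ (short_weight om theta' h' N L)); last by rewrite lerDr.
apply: (ler_sum2_term (F := fun i m => expR (theta' *
  (\sum_(i.+1 <= l < (i + m).+1) om l - h')))) => [? ?||].
- exact: expR_ge0.
- by rewrite ltnS (leq_trans (leq_addr _ _) imN).
- by rewrite ltnS.
Qed.

Lemma geometric_sum_le (R : realType) (r : R) (n : nat) :
  0 <= r -> r < 1 -> \sum_(0 <= m < n) r ^+ m <= (1 - r)^-1.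
Proof.
move=> r0 r1; have r1' : 0 < 1 - r by rewrite subr_gt0.
rewrite -[leRHS]mul1r ler_pdivlMr// mulrC big_mkord.
by rewrite -opprB mulNr -subrX1 opprB gerBl exprn_ge0.
Qed.

Lemma integral_sum2_le d (T : measurableType d) (R : realType)
    (P : probability T R) (F : nat -> nat -> T -> R) (B : nat -> R) (a c : nat) (C : R) :
  (forall i j, measurable_fun setT (F i j)) -> (forall i j x, 0 <= F i j x) ->
  (forall i j, (j < c)%N -> (\int[P]_x (F i j x)%:E <= (B j)%:E)%E) ->
  \sum_(0 <= j < c) B j <= C ->
  (\int[P]_x (\sum_(0 <= i < a) \sum_(0 <= j < c) F i j x)%:E <= (a%:R * C)%:E)%E.
Proof.
move=> mF F0 FB BC.
have F0' i j x : (0 <= (F i j x)%:E)%E by rewrite lee_fin.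
have mF' i j : measurable_fun setT (fun x => (F i j x)%:E) by exact/measurable_EFinP.
under eq_integral => x _.
  rewrite -sumEFin; under eq_bigr do rewrite -sumEFin; over.
rewrite ge0_integral_sum//; last 2 first.
- by move=> i; exact: emeasurable_sum.
- by move=> i x _; exact: sume_ge0.
apply: (@le_trans _ _ (\sum_(0 <= i < a) C%:E)%E).
  apply: lee_sum => i _; rewrite ge0_integral_sum//.
  apply: (@le_trans _ _ (\sum_(0 <= j < c) (B j)%:E)%E).
    by rewrite !big_mkord; apply: lee_sum => j _; exact: FB.
  by rewrite sumEFin lee_fin.
by rewrite sumEFin lee_fin sumr_const_nat subn0 mulr_natl.
Qed.

Lemma shifted_sum_mgf_le d (T : measurableType d) (R : realType)
    (P : probability T R) (omega : nat -> {RV P >-> R}) (theta m c y : R) (i n : nat) :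
  iid_environment omega -> 0 <= m <= expR c ->
  (\int[P]_x (expR (theta * omega 1%N x))%:E = m%:E)%E ->
  (\int[P]_x (expR (theta * (\sum_(i.+1 <= l < (i + n).+1) omega l x - y)))%:E
    <= (expR (n%:R * c - theta * y))%:E)%E.
Proof.
move=> iid mc Em.
have mS : measurable_fun setT
    (fun x => expR (theta * \sum_(i.+1 <= l < (i + n).+1) omega l x)).
  apply: measurableT_comp => //; apply: measurable_funM => //.
  exact: measurable_sum.
under eq_integral do rewrite mulrBr addrC expRD EFinM.
rewrite ge0_integralZl_EFin ?expR_ge0//.
- rewrite addrC expRD EFinM lee_wpmul2l ?lee_fin ?expR_ge0//.
  exact: partial_sum_mgf_le mc Em.
- exact/measurable_EFinP.
Qed.

Lemma measurable_shifted_exp d (T : measurableType d) (R : realType)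
    (P : probability T R) (omega : nat -> {RV P >-> R}) (theta y : R) (a c : nat) :
  measurable_fun setT (fun x => expR (theta * (\sum_(a <= l < c) omega l x - y))).
Proof.
apply: measurableT_comp => //; apply: measurable_funM => //.
by apply: measurable_funB => //; exact: measurable_sum.
Qed.

(** The drift over [L] sites exceeds what the variance costs by [rho], so the
sum over the end points is a geometric series, and only the number of starting
points remains. *)
Lemma grid_weight_mean_le d (T : measurableType d) (R : realType)
    (P : probability T R) (omega : nat -> {RV P >-> R}) (theta m c dr h rho : R)
    (N L : nat) :
  iid_environment omega -> 0 <= m <= expR c ->
  (\int[P]_x (expR (theta * omega 1%N x))%:E = m%:E)%E ->
  0 < rho -> rho <= L%:R * (theta * dr - c) ->
  (\int[P]_x (grid_weight (fun l => omega l x) theta dr h N L)%:E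
    <= ((N %/ L).+1%:R * (expR (- (theta * h)) / (1 - expR (- rho))))%:E)%E.
Proof.
move=> iid mc Em rho0 rhoL.
apply: (integral_sum2_le
  (B := fun k => expR (- (theta * h)) * expR (- rho) ^+ k)).
- by move=> i j; under eq_fun do rewrite -addrA -opprD; exact: measurable_shifted_exp.
- by move=> i j x; exact: expR_ge0.
- move=> i j _; under eq_integral do rewrite -addrA -opprD.
  apply: (le_trans (shifted_sum_mgf_le _ _ _ iid mc Em)).
  rewrite lee_fin -expRM_natl -expRD ler_expR natrM.
  by have := ler_wpM2l (ler0n R j) rhoL; lra.
- rewrite -mulr_sumr ler_wpM2l ?expR_ge0//; apply: geometric_sum_le.
    exact: expR_ge0.
  by rewrite -expR0 ltr_expR oppr_lt0.
Qed.

Lemma short_weight_mean_le d (T : measurableType d) (R : realType)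
    (P : probability T R) (omega : nat -> {RV P >-> R}) (theta m c h : R)
    (N L : nat) :
  iid_environment omega -> 0 <= m <= expR c -> 0 <= c ->
  (\int[P]_x (expR (theta * omega 1%N x))%:E = m%:E)%E ->
  (\int[P]_x (short_weight (fun l => omega l x) theta h N L)%:E
    <= (N.+1%:R * (L.+1%:R * expR (L%:R * c - theta * h)))%:E)%E.
Proof.
move=> iid mc c0 Em.
apply: (integral_sum2_le (B := fun=> expR (L%:R * c - theta * h))).
- by move=> i j; exact: measurable_shifted_exp.
- by move=> i j x; exact: expR_ge0.
- move=> i j; rewrite ltnS => jL.
  apply: (le_trans (shifted_sum_mgf_le _ _ _ iid mc Em)).
  by rewrite lee_fin ler_expR lerD2r ler_wpM2r// ler_nat.
- by rewrite sumr_const_nat subn0 [leRHS]mulr_natl.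
Qed.

Lemma measurable_weights d (T : measurableType d) (R : realType)
    (P : probability T R) (omega : nat -> {RV P >-> R}) (theta dr h : R)
    (N L : nat) :
  measurable_fun setT (fun x => grid_weight (fun l => omega l x) theta dr h N L) /\
  measurable_fun setT (fun x => short_weight (fun l => omega l x) theta h N L).
Proof.
split; do 2 (apply: measurable_sum => ?); last exact: measurable_shifted_exp.
by under eq_fun do rewrite -addrA -opprD; exact: measurable_shifted_exp.
Qed.

(** * Choice of the scale *)

(** With [x = ln t / ln (ln t)] this is the site [(1 - epsilon) s(t)]. *)
Definition target_site (R : realType) (b alpha sigma2 epsilon x : R) : nat :=
  Num.truncn ((1 - epsilon) * (Cstar b alpha sigma2 * x) `^ alpha^-1).

Lemma Cstar_gt0 (R : realType) (b alpha sigma2 : R) :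
  0 < b -> 0 < alpha -> alpha < 1 / 2 -> 0 < sigma2 -> 0 < Cstar b alpha sigma2.
Proof.
move=> b0 a0 a1 s0; rewrite /Cstar divr_gt0 ?mulr_gt0//.
by rewrite subr_gt0 mulrC -ltr_pdivlMr.
Qed.

(** The factor [(1 - epsilon)^-alpha > 1] is the gain that the whole proof lives
on. The rest of the left side is the critical drift: the Chernoff exponent of a
climb of height [ln t] against it is [(1/alpha - 2) ln (ln t)]. *)
Lemma drift_ge (R : realType) (b alpha sigma2 epsilon x : R) (l : nat) :
  0 < b -> 0 < alpha -> alpha < 1 / 2 -> 0 < sigma2 ->
  epsilon < 1 -> 0 < x -> (1 <= l <= target_site b alpha sigma2 epsilon x)%N ->
  (1 - epsilon) `^ (- alpha) * sigma2 * (alpha^-1 - 2) / 2 / x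
    <= b * l%:R `^ (- alpha).
Proof.
move=> b0 a0 a1 s0 e1 x0 /andP[l1 lN].
have C0 := Cstar_gt0 b0 a0 a1 s0.
have e1' : 0 < 1 - epsilon by rewrite subr_gt0.
have Cx0 : 0 < Cstar b alpha sigma2 * x by rewrite mulr_gt0.
set y := (1 - epsilon) * (Cstar b alpha sigma2 * x) `^ alpha^-1.
have y0 : 0 < y by rewrite mulr_gt0// powR_gt0.
have l0 : (0 : R) < l%:R by rewrite ltr0n.
have ly : l%:R <= y.
  by apply: (@le_trans _ _ (Num.truncn y)%:R); rewrite ?ler_nat ?truncn_le ?ltW.
have yE : y `^ alpha = (1 - epsilon) `^ alpha * (Cstar b alpha sigma2 * x).
  rewrite /y (powRM _ (ltW e1') (powR_ge0 _ _)) -powRrM mulVf ?gt_eqF// powRr1//.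
  exact: ltW.
have lya : l%:R `^ alpha <= y `^ alpha.
  by apply: ge0_ler_powR; rewrite ?nnegrE// ltW.
rewrite !powRN; apply: (@le_trans _ _ (b * (y `^ alpha)^-1)); last first.
  by rewrite ler_wpM2l ?(ltW b0)// lef_pV2// posrE powR_gt0.
rewrite yE le_eqVlt; apply/orP; left; apply/eqP.
have E0 : (1 - epsilon) `^ alpha != 0 by rewrite gt_eqF ?powR_gt0.
rewrite /Cstar; field.
rewrite E0 (gt_eqF x0) (gt_eqF a0) (gt_eqF b0) (gt_eqF s0) /=.
lra.
Qed.

Lemma powR_le_expR (R : realType) (x y a : R) :
  1 <= x -> x <= expR y -> 0 <= a -> x `^ a <= expR (a * y).
Proof.
move=> x1 xy a0; have x0 : 0 <= x by apply: le_trans x1.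
apply: (@le_trans _ _ (expR y `^ a)).
  by apply: ge0_ler_powR; rewrite ?nnegrE// expR_ge0.
by rewrite -expRM mulrC.
Qed.

Lemma expR_div_id_bounds (R : realType) (u : R) : 1 <= u ->
  [/\ 1 <= expR u / u, expR u / u <= expR u & u / 2 <= expR u / u].
Proof.
move=> u1; have u0 : 0 < u by apply: lt_le_trans u1.
split.
- by rewrite ler_pdivlMr// mul1r (le_trans _ (expR_ge1Dx u))// lerDr.
- by rewrite ler_pdivrMr// ler_peMr// expR_ge0.
- rewrite ler_pdivlMr//.
  have := expR_ge1Dxn 1 (ltW u0); rewrite -[2`!]/2%N expr2; lra.
Qed.

(** The grid has mesh [L], about [x^2]: the number of its points is of order
[x^(1/alpha - 2)], while a bound of the right power of [e^u] is enough for the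
number of short intervals. *)
Lemma site_counts (R : realType) (b alpha sigma2 epsilon x u : R) :
  0 < b -> 0 < alpha -> alpha < 1 / 2 -> 0 < sigma2 -> 0 < epsilon ->
  epsilon < 1 -> 1 <= x -> x <= expR u ->
  let N := target_site b alpha sigma2 epsilon x in
  let L := (Num.truncn (x ^+ 2)).+1 in
  let K := Cstar b alpha sigma2 `^ alpha^-1 + 1 in
  [/\ x ^+ 2 <= L%:R, L%:R <= 2 * x ^+ 2,
    (N %/ L).+1%:R <= K * expR ((alpha^-1 - 2) * u) &
    N.+1%:R * L.+1%:R <= 3 * K * expR ((alpha^-1 + 2) * u)].
Proof.
move=> b0 a0 a1 s0 e0 e1 x1 xu N L K.
have C0 := Cstar_gt0 b0 a0 a1 s0.
have x0 : 0 < x by apply: lt_le_trans x1.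
have u0 : 0 <= u by rewrite -ler_expR expR0 (le_trans x1).
have ai2 : 2 < alpha^-1.
  by rewrite -[2]invrK ltf_pV2 ?posrE ?invr_gt0//; lra.
have xx1 : 1 <= x ^+ 2 by rewrite exprn_ege1.
have xx0 : 0 < x ^+ 2 by rewrite exprn_gt0.
have L1 : x ^+ 2 <= L%:R by rewrite ltW// truncnS_gt.
have L2 : L%:R <= x ^+ 2 + 1.
  by rewrite -natr1 lerD2r truncn_le ltW.
pose K1 := Cstar b alpha sigma2 `^ alpha^-1.
have K10 : 0 <= K1 by exact: powR_ge0.
have NK : N%:R <= K1 * x `^ alpha^-1.
  apply: (@le_trans _ _ ((1 - epsilon) * (Cstar b alpha sigma2 * x) `^ alpha^-1)).
    by rewrite truncn_le mulr_ge0 ?powR_ge0// subr_ge0 ltW.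
  rewrite (powRM _ (ltW C0) (ltW x0)) ger_pMl ?mulr_gt0 ?powR_gt0//.
  by rewrite gerBl ltW.
have xE : x `^ alpha^-1 = x `^ (alpha^-1 - 2) * x ^+ 2.
  rewrite -powR_mulrn ?(ltW x0)// -powRD ?subrK//.
  by rewrite (gt_eqF x0) implybT.
have g0 : 0 <= alpha^-1 - 2 by lra.
have ex1 (r : R) : 0 <= r -> 1 <= expR (r * u).
  by move=> r0; rewrite -expR0 ler_expR mulr_ge0.
split => //.
- by apply: (le_trans L2); lra.
- rewrite -natr1 /K mulrDl mul1r lerD ?ex1//.
  apply: (@le_trans _ _ (N%:R / L%:R)).
    rewrite ler_pdivlMr; last by apply: lt_le_trans L1.
    by rewrite -natrM ler_nat leq_trunc_div.
  apply: (@le_trans _ _ (K1 * x `^ alpha^-1 / x ^+ 2)).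
    apply: ler_pM => //.
    by rewrite lef_pV2// posrE ltr0n.
  rewrite xE mulrA mulfK ?gt_eqF// ler_wpM2l//.
  exact: powR_le_expR.
- have -> : 3 * K * expR ((alpha^-1 + 2) * u) =
      (K * expR (alpha^-1 * u)) * (3 * expR (2 * u)).
    by rewrite [(alpha^-1 + 2) * u]mulrDl expRD; ring.
  apply: ler_pM => //.
    rewrite -natr1 /K mulrDl mul1r lerD ?ex1//; last by lra.
    apply: (le_trans NK); rewrite ler_wpM2l// powR_le_expR//; lra.
  rewrite -natr1; apply: (@le_trans _ _ (3 * x ^+ 2)); first by lra.
  rewrite ler_wpM2l// -powR_mulrn ?(ltW x0)//.
  exact: powR_le_expR.
Qed.

(** Here [u] stands for [ln (ln t)]. The Chernoff parameter [kap / x] is chosen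
with [kap = g (1 + c1)], where [g = 1/alpha - 2] is the exponent of the number
of grid points. As [kap > g], the bound beats this number even at the slightly
lower height [(1 - 4 delta) e^u]; as [(1 + c1)^2 < A], where [A] is the gain in
the drift and one factor [1 + c1] is for the variance, the bound still decreases
with the length. For the short intervals the variance costs a constant only, so
the parameter can be any multiple of [1 / x], and a large one beats every power
of [e^u]. *)
Lemma exists_climb_weight (R : realType) (d : measure_display)
    (Omega : measurableType d) (P : probability Omega R)
    (omega : nat -> {RV P >-> R}) (b alpha sigma2 theta0 epsilon : R) :
  0 < b -> 0 < alpha -> alpha < 1 / 2 -> iid_environment omega ->
  ('E_P[omega 1%N] = 0)%E -> 0 < sigma2 ->
  ('E_P[(fun w => omega 1%N w ^+ 2)%R] = sigma2%:E)%E ->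
  0 < theta0 ->
  (forall theta : R, `|theta| < theta0 ->
     ('E_P[(fun w => expR (theta * omega 1%N w))%R] < +oo)%E) ->
  0 < epsilon -> epsilon < 1 ->
  exists delta c C u0 : R, exists W : R -> Omega -> R,
  [/\ 0 < delta < 1 / 4, 0 < c,
    forall u, measurable_fun setT (W u) /\ forall w, 0 <= W u w,
    forall u, u0 <= u -> (\int[P]_w (W u w)%:E <= (C * expR (- (c * u)))%:E)%E &
    forall u w, u0 <= u -> W u w < 1 ->
      forall i j, (i <= j <= target_site b alpha sigma2 epsilon (expR u / u))%N ->
      climb b alpha (fun l => omega l w) i j <= (1 - 2 * delta) * expR u].
Proof.
move=> b0 a0 a1 iid mean0 s0 var th0 mgf e0 e1.
have [g gE] : {g | g = alpha^-1 - 2} by exists (alpha^-1 - 2).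
have ai2 : 2 < alpha^-1 by rewrite -[2]invrK ltf_pV2 ?posrE ?invr_gt0//; lra.
have g0 : 0 < g by rewrite gE subr_gt0.
have [A AE] : {A | A = (1 - epsilon) `^ (- alpha)} by exists ((1 - epsilon) `^ (- alpha)).
have A1 : 1 < A.
  rewrite AE powRN -[X in X < _]invr1 ltf_pV2 ?posrE ?powR_gt0 ?subr_gt0//.
  have p1 : (1 : R) `^ alpha = 1 by rewrite powR1.
  rewrite -[X in _ < X]p1; apply: gt0_ltr_powR; rewrite ?nnegrE//.
    by rewrite subr_ge0 ltW.
  by rewrite gtrBl.
have [c1 [c10 c11 c1A]] : exists c1, [/\ 0 < c1, c1 <= 1 & c1 <= (A - 1) / 4].
  exists (Num.min 1 ((A - 1) / 4)); rewrite lt_min !ge_min !lexx orbT ltr01 /=.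
  by split => //; rewrite divr_gt0// subr_gt0.
have c1A2 : (1 + c1) ^+ 2 < A.
  have : c1 ^+ 2 <= c1 by rewrite expr2 ler_piMr// ltW.
  by rewrite sqrrD expr1n; lra.
have [v vE] : {r | r = sigma2 * (1 + c1)} by exists (sigma2 * (1 + c1)).
have sv : sigma2 < v by rewrite vE mulrDr mulr1 ltrDl mulr_gt0.
have v0 : 0 < v by apply: lt_trans sv.
have [th1 th10 mgfb] := mgf_le mean0 var th0 mgf sv.
have [kap kapE] : {r | r = g * (1 + c1)} by exists (g * (1 + c1)).
have kap0 : 0 < kap by rewrite kapE mulr_gt0// addr_gt0.
(* This makes [kap * (1 - 4 del) = g * (1 + c1 / 2)], see [delE]. *)
pose del := c1 / (8 * (1 + c1)).
have del0 : 0 < del by rewrite divr_gt0// mulr_gt0// addr_gt0.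
have del4 : del < 1 / 4 by rewrite ltr_pdivrMr ?mulr_gt0 ?addr_gt0//; lra.
have delE : (1 + c1) * (1 - 4 * del) = 1 + c1 / 2.
  by rewrite /del; field; rewrite gt_eqF// addr_gt0.
(* The short weights number [exp ((1/alpha + 2) u)], and one more power of
   [exp u] is wanted in the end. *)
have [K KE] : {r | r = (alpha^-1 + 3) / del} by exists ((alpha^-1 + 3) / del).
have K0 : 0 < K by rewrite KE divr_gt0// addr_gt0// invr_gt0.
(* What the drift leaves over a length [x^2] once the variance is paid. *)
pose rho := kap * sigma2 * g / 2 * (A - (1 + c1) ^+ 2).
have rho0 : 0 < rho by rewrite mulr_gt0 ?subr_gt0// divr_gt0// !mulr_gt0.
pose x (u : R) := expR u / u.
pose N (u : R) := target_site b alpha sigma2 epsilon (x u).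
pose L (u : R) := (Num.truncn (x u ^+ 2)).+1.
pose dr u := A * sigma2 * g / 2 / x u.
pose W u w := grid_weight (fun l => omega l w) (kap / x u) (dr u)
    ((1 - 4 * del) * expR u) (N u) (L u)
  + short_weight (fun l => omega l w) (K / x u) (del * expR u) (N u) (L u).
pose Kc := Cstar b alpha sigma2 `^ alpha^-1 + 1.
have Kc0 : 0 <= Kc by rewrite addr_ge0// powR_ge0.
pose C1 := Kc / (1 - expR (- rho)).
have erho : 0 < 1 - expR (- rho).
  by rewrite subr_gt0 -[ltRHS]expR0 ltr_expR oppr_lt0.
have C10 : 0 <= C1 by rewrite divr_ge0// ltW.
pose C2 := 3 * Kc * expR (K ^+ 2 * v).
have C20 : 0 <= C2 by rewrite mulr_ge0 ?expR_ge0// mulr_ge0.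
(* From [u0] on, both Chernoff parameters are in the range of [mgf_le]. *)
pose u0 := Num.max 1 (2 * (kap + K) / th1).
have uP u : u0 <= u -> [/\ 1 <= u, 0 < x u, 1 <= x u, x u <= expR u &
    (kap + K) / x u <= th1].
  rewrite ge_max => /andP[u1 uk]; have [x1 x2 x3] := expR_div_id_bounds u1.
  have x0 : 0 < x u by apply: lt_le_trans x1.
  split => //; rewrite ler_pdivrMr// mulrC -ler_pdivrMr//.
  apply: le_trans x3; rewrite ler_pdivlMr//.
  by apply: le_trans uk; rewrite mulrAC [_ * 2]mulrC.
have gw0 u w : 0 <= grid_weight (fun l => omega l w) (kap / x u) (dr u)
    ((1 - 4 * del) * expR u) (N u) (L u).
  by do 2 (apply: sumr_ge0 => ? _); exact: expR_ge0.
have sw0 u w : 0 <= short_weight (fun l => omega l w) (K / x u) (del * expR u)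
    (N u) (L u).
  by do 2 (apply: sumr_ge0 => ? _); exact: expR_ge0.
exists del, (Num.min (g * c1 / 2) 1), (C1 + C2), u0, W; split.
- by rewrite del0.
- by rewrite lt_min ltr01 andbT divr_gt0// mulr_gt0.
- move=> u; split; last by move=> w; rewrite addr_ge0.
  apply: measurable_funD.
    exact: (measurable_weights _ _ _ _ _ _).1.
  exact: (measurable_weights _ _ 0 _ _ _).2.
- move=> u /uP[u1 xu0 x1 xe xth].
  have un0 : u != 0 by rewrite gt_eqF// (lt_le_trans _ u1).
  have xn0 : x u != 0 by rewrite gt_eqF.
  have ex : expR u / x u = u by rewrite /x invf_div mulrCA mulfV ?mulr1// gt_eqF ?expR_gt0.
  have [L1 L2 NL1 NL2] := site_counts b0 a0 a1 s0 e0 e1 x1 xe.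
  rewrite -/(N u) -/(L u) -/Kc in L1 L2 NL1 NL2.
  have kth : 0 <= kap / x u <= th1.
    rewrite divr_ge0 ?(ltW kap0) ?(ltW xu0)//=; apply: le_trans xth.
    by rewrite ler_wpM2r ?invr_ge0 ?(ltW xu0)// lerDl ltW.
  have Kth : 0 <= K / x u <= th1.
    rewrite divr_ge0 ?(ltW K0) ?(ltW xu0)//=; apply: le_trans xth.
    by rewrite ler_wpM2r ?invr_ge0 ?(ltW xu0)// lerDr ltW.
  have [m mb mE] := mgfb _ kth; have [m' mb' mE'] := mgfb _ Kth.
  have rhoL : rho <= (L u)%:R * (kap / x u * dr u - (kap / x u) ^+ 2 * v / 2).
    have -> : kap / x u * dr u - (kap / x u) ^+ 2 * v / 2 = rho / x u ^+ 2.
      by rewrite /dr /rho vE kapE; field.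
    by rewrite mulrCA ler_peMr ?(ltW rho0)// ler_pdivlMr ?mul1r ?exprn_gt0.
  have grid := grid_weight_mean_le ((1 - 4 * del) * expR u) (N u) iid mb mE rho0 rhoL.
  have c'0 : 0 <= (K / x u) ^+ 2 * v / 2.
    by rewrite divr_ge0// mulr_ge0 ?sqr_ge0 ?(ltW v0).
  have short := short_weight_mean_le (del * expR u) (N u) (L u) iid mb' c'0 mE'.
  rewrite /W; under eq_integral do rewrite EFinD.
  rewrite ge0_integralD//=; last 4 first.
  - by move=> w _; rewrite lee_fin.
  - exact/measurable_EFinP/(measurable_weights _ _ _ _ _ _).1.
  - by move=> w _; rewrite lee_fin.
  - exact/measurable_EFinP/(measurable_weights _ _ 0 _ _ _).2.
  have u0' : 0 <= u by apply: le_trans u1.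
  have Dinv : 0 <= (1 - expR (- rho))^-1 by rewrite invr_ge0 ltW.
  have hE : kap / x u * ((1 - 4 * del) * expR u) = g * (1 + c1 / 2) * u.
    transitivity (g * ((1 + c1) * (1 - 4 * del)) * (expR u / x u)).
      by rewrite kapE; ring.
    by rewrite ex delE.
  have h'E : K / x u * (del * expR u) = (alpha^-1 + 3) * u.
    transitivity (K * del * (expR u / x u)); first by ring.
    by rewrite ex KE divfK// gt_eqF.
  have Lc' : (L u)%:R * ((K / x u) ^+ 2 * v / 2) <= K ^+ 2 * v.
    apply: (le_trans (ler_wpM2r c'0 L2)).
    by rewrite le_eqVlt; apply/orP; left; apply/eqP; field.
  apply: (le_trans (leeD grid short)); rewrite -EFinD lee_fin [leRHS]mulrDl.
  rewrite hE h'E; apply: lerD.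
    apply: (@le_trans _ _ (Kc * expR (g * u) *
        (expR (- (g * (1 + c1 / 2) * u)) / (1 - expR (- rho))))).
      rewrite ler_wpM2r ?mulr_ge0 ?expR_ge0//.
      by rewrite gE.
    have -> : Kc * expR (g * u) * (expR (- (g * (1 + c1 / 2) * u)) /
        (1 - expR (- rho))) = C1 * expR (g * u + - (g * (1 + c1 / 2) * u)).
      by rewrite expRD /C1; ring.
    rewrite ler_wpM2l// ler_expR.
    have -> : g * u + - (g * (1 + c1 / 2) * u) = - (g * c1 / 2 * u) by ring.
    by rewrite lerN2 ler_wpM2r// ge_min lexx.
  rewrite mulrA; apply: (@le_trans _ _ (3 * Kc * expR ((alpha^-1 + 2) * u) *
      expR (K ^+ 2 * v - (alpha^-1 + 3) * u))).
    by rewrite ler_pM ?mulr_ge0 ?expR_ge0// ler_expR lerD2r.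
  have -> : 3 * Kc * expR ((alpha^-1 + 2) * u) *
      expR (K ^+ 2 * v - (alpha^-1 + 3) * u) = C2 * expR (- u).
    rewrite /C2 -!mulrA -!expRD; congr (_ * (_ * expR _)); ring.
  by rewrite ler_wpM2l// ler_expR lerN2 ger_pMl ?ge_min ?lexx ?orbT// (lt_le_trans _ u1).
- move=> u w /uP[u1 xu0 x1 xe xth] W1 i j ijN.
  have -> : (1 - 2 * del) * expR u = (1 - 4 * del) * expR u + 2 * (del * expR u).
    by ring.
  apply: (climb_le_of_weight _ _ _ _ _ _ _ W1) => //.
  + have A0 : 0 < A by apply: lt_trans A1.
    by rewrite /dr ltW// divr_gt0// divr_gt0// !mulr_gt0.
  + by rewrite mulr_ge0 ?expR_ge0//; lra.
  + by rewrite mulr_ge0 ?expR_ge0// ltW.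
  + by rewrite divr_gt0.
  + by rewrite divr_gt0.
  + by move=> l lN; rewrite /dr gE AE; exact: drift_ge.
Qed.

(** * Almost sure bound on the climbs *)

(** The sum of the [W k] has a finite mean, so it converges almost surely. *)
Lemma ae_eventually_lt1 d (T : measurableType d) (R : realType)
    (P : probability T R) (W : nat -> T -> R) (C r : R) (k0 : nat) :
  (forall k, measurable_fun setT (W k)) -> (forall k x, 0 <= W k x) ->
  0 <= r -> r < 1 ->
  (forall k, (k0 <= k)%N -> (\int[P]_x (W k x)%:E <= (C * r ^+ k)%:E)%E) ->
  {ae P, forall x, \forall k \near \oo, W k x < 1}.
Proof.
move=> mW W0 r0 r1 WC.
have C0 k : (k0 <= k)%N -> 0 <= C * r ^+ k.
  by move=> /WC; rewrite -lee_fin; apply: le_trans; apply: integral_ge0 => x _;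
    rewrite lee_fin.
pose Z (x : T) : \bar R := (\sum_(k <oo) (W (k + k0)%N x)%:E)%E.
have mEW k : measurable_fun setT (fun x => (W (k + k0)%N x)%:E).
  exact/measurable_EFinP.
have EW0 k x : (0 <= (W (k + k0)%N x)%:E)%E by rewrite lee_fin.
have Z0 x : (0 <= Z x)%E by exact: nneseries_ge0.
have mZ : measurable_fun setT Z by exact: ge0_emeasurable_sum.
have intZ : (\int[P]_x Z x < +oo)%E.
  rewrite /Z integral_nneseries//.
  have S n : \sum_(0 <= k < n) C * r ^+ (k + k0) <= (C * r ^+ k0) * (1 - r)^-1.
    under eq_bigr do rewrite exprD mulrCA mulrC.
    by rewrite -mulr_sumr ler_wpM2l ?C0// geometric_sum_le.
  apply: (@le_lt_trans _ _ ((C * r ^+ k0) * (1 - r)^-1)%:E); last exact: ltry.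
  apply: lime_le; first by apply: is_cvg_nneseries => k _ _; exact: integral_ge0.
  apply: nearW => n; apply: le_trans (_ : _ <= (\sum_(0 <= k < n) C * r ^+ (k + k0))%:E)%E _.
    by rewrite -sumEFin; apply: lee_sum => k _; apply: WC; rewrite leq_addl.
  by rewrite lee_fin.
have iZ : P.-integrable setT Z.
  apply/integrableP; split => //.
  by under eq_integral do rewrite gee0_abs//.
apply: filterS (integrable_ae measurableT iZ) => x /(_ I) Zfin.
have Zoo : (Z x < +oo)%E by rewrite ltey_eq Zfin.
have tail0 := nneseries_tail_cvg Zoo (fun k _ => EW0 k x).
have : \forall n \near \oo, (\sum_(n <= k <oo) (W (k + k0)%N x)%:E < 1)%E.
  by apply: (tail0 (fun y => (y < 1)%E)); apply: open_ereal_lt'; exact: lte01.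
move=> [n _ small]; exists (n + k0)%N => // k /= nk.
have kk : k = (k - k0 + k0)%N by rewrite subnK//; apply: leq_trans nk; rewrite leq_addl.
have nk' : (n <= k - k0)%N by lia.
rewrite -lte_fin; apply: le_lt_trans (small _ nk'); rewrite {1}kk.
apply: le_trans (nneseries_lim_ge (k - k0).+1 _) => //.
by rewrite big_nat1.
Qed.

Lemma expR_div_id_mono (R : realType) (u u' : R) :
  1 <= u -> u <= u' -> expR u / u <= expR u' / u'.
Proof.
move=> u1 uu'; have u0 : 0 < u by apply: lt_le_trans u1.
have u'0 : 0 < u' by apply: lt_le_trans uu'.
rewrite ler_pdivrMr// mulrAC ler_pdivlMr//.
have -> : expR u' = expR u * expR (u' - u) by rewrite -expRD addrC subrK.
rewrite -mulrA ler_wpM2l ?expR_ge0//.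
have := expR_ge1Dx (u' - u) => /(ler_wpM2r (ltW u0)); apply: le_trans.
nra.
Qed.

Lemma target_site_mono (R : realType) (b alpha sigma2 epsilon x y : R) :
  0 < b -> 0 < alpha -> alpha < 1 / 2 -> 0 < sigma2 -> epsilon < 1 ->
  0 <= x -> x <= y ->
  (target_site b alpha sigma2 epsilon x <= target_site b alpha sigma2 epsilon y)%N.
Proof.
move=> b0 a0 a1 s0 e1 x0 xy; have C0 := Cstar_gt0 b0 a0 a1 s0.
apply: le_truncn; rewrite ler_wpM2l ?subr_ge0 ?(ltW e1)//.
apply: ge0_ler_powR; rewrite ?nnegrE ?invr_ge0 ?(ltW a0)//.
- by rewrite mulr_ge0// ltW.
- by rewrite mulr_ge0 ?(ltW C0)// (le_trans x0).
- by rewrite ler_wpM2l// ltW.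
Qed.

(** Almost surely the bound holds along [u = eta k] for large [k]. In between,
the climbs before a site increase with the site, and [eta] is such that
passing from [u] to the next multiple of [eta] costs the factor
[(1 - delta) / (1 - 2 delta)] only. *)
Lemma environment_climb_le (R : realType) (d : measure_display)
    (Omega : measurableType d) (P : probability Omega R)
    (omega : nat -> {RV P >-> R}) (b alpha sigma2 theta0 epsilon : R) :
  0 < b -> 0 < alpha -> alpha < 1 / 2 -> iid_environment omega ->
  ('E_P[omega 1%N] = 0)%E -> 0 < sigma2 ->
  ('E_P[(fun w => omega 1%N w ^+ 2)%R] = sigma2%:E)%E ->
  0 < theta0 ->
  (forall theta : R, `|theta| < theta0 ->
     ('E_P[(fun w => expR (theta * omega 1%N w))%R] < +oo)%E) ->
  0 < epsilon -> epsilon < 1 ->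
  exists2 delta : R, 0 < delta &
  {ae P, forall w, \forall u \near +oo%R, forall i j,
    (i <= j <= target_site b alpha sigma2 epsilon (expR u / u))%N ->
    climb b alpha (fun l => omega l w) i j <= (1 - delta) * expR u}.
Proof.
move=> b0 a0 a1 iid mean0 s0 var th0 mgf e0 e1.
have [del [c [C [u0 [W [/andP[del0 del4] c0 mW WC Wclimb]]]]]] :=
  exists_climb_weight b0 a0 a1 iid mean0 s0 var th0 mgf e0 e1.
exists del => //.
pose eta := ln ((1 - del) / (1 - 2 * del)).
have d2 : 0 < 1 - 2 * del by lra.
have d1 : 0 < 1 - del by lra.
have eta0 : 0 < eta by rewrite ln_gt0// ltr_pdivlMr//; lra.
have eE : expR eta = (1 - del) / (1 - 2 * del).
  by rewrite lnK// posrE divr_gt0.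
pose k0 := (Num.truncn (u0 / eta)).+1.
have k0u k : (k0 <= k)%N -> u0 <= eta * k%:R.
  move=> kk; rewrite mulrC -ler_pdivrMr//; apply/ltW.
  by apply: (lt_le_trans (truncnS_gt _)); rewrite ler_nat.
have ae1 : {ae P, forall w, \forall k \near \oo, W (eta * k%:R) w < 1}.
  apply: (@ae_eventually_lt1 _ _ _ P (fun k => W (eta * k%:R)) C
    (expR (- (c * eta))) k0).
  - by move=> k; have [] := mW (eta * k%:R).
  - by move=> k; have [] := mW (eta * k%:R).
  - exact: expR_ge0.
  - by rewrite -[ltRHS]expR0 ltr_expR oppr_lt0 mulr_gt0.
  - move=> k /k0u/WC; rewrite -expRM_natl.
    by rewrite (_ : k%:R * - (c * eta) = - (c * (eta * k%:R)))//; ring.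
apply: filterS ae1 => w [K _ WK].
exists (Num.max 1 (eta * (maxn K k0)%:R)); split; first exact: num_real.
move=> u; rewrite gt_max => /andP[u1 uK] i j /andP[ij jN].
(* The first multiple of [eta] above [u]. *)
pose k := (Num.truncn (u / eta)).+1.
have uk : u <= eta * k%:R by rewrite mulrC -ler_pdivrMr// ltW// truncnS_gt.
have ku : eta * k%:R <= eta + u.
  rewrite -natr1 mulrDr mulr1 addrC lerD2l mulrC -ler_pdivlMr//.
  by rewrite truncn_le divr_ge0 ?(ltW eta0)// (le_trans _ (ltW u1)).
have kK : (maxn K k0 <= k)%N.
  rewrite -(ler_nat R) -(ler_pM2l eta0).
  by apply: le_trans uk; exact: ltW.
have Kk : (K <= k)%N by apply: leq_trans kK; exact: leq_maxl.
have k0k : (k0 <= k)%N by apply: leq_trans kK; exact: leq_maxr.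
have x0 : 0 <= expR u / u by rewrite divr_ge0 ?expR_ge0// (le_trans _ (ltW u1)).
have := Wclimb _ w (k0u _ k0k) (WK _ Kk) i j.
rewrite ij (leq_trans jN); last first.
  by apply: target_site_mono => //; apply: expR_div_id_mono => //; exact: ltW.
move=> /(_ isT) /le_trans; apply.
apply: (@le_trans _ _ ((1 - 2 * del) * expR (eta + u))).
  by rewrite ler_wpM2l ?(ltW d2)// ler_expR.
by rewrite expRD eE mulrA [(1 - 2 * del) * _]mulrC divfK// gt_eqF.
Qed.

(** * The tail of the hitting time *)

Lemma powR_le_expR_eventually (R : realType) (C r a B : R) :
  0 < C -> 0 < a -> exists U : R, forall y, U <= y -> B * (C * y) `^ r <= expR (a * y).
Proof.
move=> C0 a0; pose n := (Num.truncn r).+1.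
have rn : r <= n%:R by rewrite ltW// truncnS_gt.
clearbody n.
pose D := `|B| * C ^+ n * n.+1`!%:R / a ^+ n.+1.
exists (Num.max C^-1 D) => y; rewrite ge_max => /andP[Cy Dy].
have y0 : 0 < y by apply: lt_le_trans Cy; rewrite invr_gt0.
have Cy1 : 1 <= C * y by rewrite mulrC -ler_pdivrMr// mul1r.
apply: (@le_trans _ _ (`|B| * (C * y) ^+ n)).
  apply: (@le_trans _ _ (`|B| * (C * y) `^ r)).
    by rewrite ler_wpM2r ?powR_ge0// ler_norm.
  rewrite ler_wpM2l// -powR_mulrn ?(le_trans ler01)//.
  exact: ler_powR.
have ay0 : 0 <= a * y by rewrite mulr_ge0// ltW.
apply: (@le_trans _ _ ((a * y) ^+ n.+1 / n.+1`!%:R)); last first.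
  by apply: le_trans (expR_ge1Dxn n ay0); rewrite lerDr.
have f0 : (0 : R) < n.+1`!%:R by rewrite ltr0n fact_gt0.
rewrite ler_pdivlMr// exprMn exprMn [a ^+ _ * _]mulrC -ler_pdivrMr ?exprn_gt0//.
rewrite (exprSr y) [leRHS]mulrC.
apply: (@le_trans _ _ (D * y ^+ n)).
  by rewrite le_eqVlt; apply/orP; left; apply/eqP; rewrite /D; ring.
by rewrite ler_wpM2r// exprn_ge0// ltW.
Qed.

Theorem mainTheorem2 (R : realType) (d : measure_display)
    (Omega : measurableType d) (P : probability Omega R)
    (omega : nat -> {RV P >-> R}) (b alpha sigma2 : R)
    (b_gt0 : 0 < b) (alpha_gt0 : 0 < alpha) (alpha_lt : alpha < 1 / 2)
    (omega_iid : iid_environment omega)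
    (mean0 : ('E_P[omega 1%N] = 0)%E)
    (sigma2_gt0 : 0 < sigma2)
    (second_moment : ('E_P[(fun w => omega 1%N w ^+ 2)%R] = sigma2%:E)%E)
    (exp_moments : exists2 theta0 : R, 0 < theta0 &
       forall theta : R, `|theta| < theta0 ->
         ('E_P[(fun w => expR (theta * omega 1%N w))%R] < +oo)%E) :
  forall epsilon : R, 0 < epsilon -> epsilon < 1 ->
  exists2 delta : R, 0 < delta &
  {ae P, forall w : Omega,
    \forall t \near +oo%R,
      forall (d' : measure_display) (T : measurableType d')
        (Pw : probability T R) (X : R -> T -> nat),
      quenched_walk b alpha (fun x => omega x w) Pw X ->
      (Pw [set w' | t%:E <
             hitting_time X
               (Num.truncn ((1 - epsilon) * front b alpha sigma2 t)) w']
       <= (expR (- (t `^ (delta / 2))))%:E)%E}.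
Proof.
move=> epsilon e0 e1; have [theta0 th0 mgf] := exp_moments.
have [delta delta0 env] := environment_climb_le b_gt0 alpha_gt0 alpha_lt omega_iid
  mean0 sigma2_gt0 second_moment th0 mgf e0 e1.
exists delta => //; apply: filterS env => w [U [_ envU]].
have C0 := Cstar_gt0 b_gt0 alpha_gt0 alpha_lt sigma2_gt0.
have d20 : 0 < delta / 2 by rewrite divr_gt0.
have [V sizeV] := powR_le_expR_eventually (2 * alpha^-1) 8 C0 d20.
have e1' : 0 < 1 - epsilon by rewrite subr_gt0.
(* [U1] is for [N] to be positive, and [V] for [8 N^2 <= t^(delta / 2)]. *)
pose U1 := 2 * (1 - epsilon)^-1 `^ alpha / Cstar b alpha sigma2.
pose u0 := Num.max (Num.max U 1) (Num.max U1 (ln (Num.max V 1))).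
exists (expR (expR u0)); split; first exact: num_real.
move=> t tt0 d' T Pw X walk.
have t0 : 0 < t by apply: lt_trans tt0; exact: expR_gt0.
pose u := ln (ln t).
have lt0 : expR u0 < ln t by rewrite -ltr_expR lnK ?posrE.
have lnt0 : 0 < ln t by apply: lt_trans lt0; exact: expR_gt0.
have eu : expR u = ln t by rewrite lnK ?posrE.
have : u0 < u by rewrite -ltr_expR eu.
rewrite !gt_max => /andP[/andP[Uu u1] /andP[U1u Vu]].
have uu0 : 0 < u by apply: lt_trans u1.
have Vt : V <= ln t.
  have : Num.max V 1 <= ln t.
    by rewrite -eu -[X in X <= _]lnK ?ler_expR ?(ltW Vu)// posrE lt_max ltr01 orbT.
  by rewrite ge_max => /andP[].
pose N := target_site b alpha sigma2 epsilon (expR u / u).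
have [x1 x2 x3] := expR_div_id_bounds (ltW u1).
have NE : Num.truncn ((1 - epsilon) * front b alpha sigma2 t) = N.
  by rewrite /N /target_site /front eu -/u -mulrA [u^-1 * _]mulrC.
rewrite NE.
have x0 : 0 < expR u / u by apply: lt_le_trans x1.
have Cx0 : 0 < Cstar b alpha sigma2 * (expR u / u) := mulr_gt0 C0 x0.
have N0 : (0 < N)%N.
  rewrite truncn_gt0 mulrC -ler_pdivrMr// mul1r.
  have -> : (1 - epsilon)^-1 = ((1 - epsilon)^-1 `^ alpha) `^ alpha^-1.
    by rewrite -powRrM mulfV ?gt_eqF// powRr1// invr_ge0 ltW.
  apply: ge0_ler_powR; rewrite ?nnegrE ?powR_ge0 ?invr_ge0 ?(ltW alpha_gt0)//.
    exact: ltW.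
  rewrite mulrC -ler_pdivrMr//; apply: le_trans x3.
  by rewrite ler_pdivlMr// mulrC mulrA; exact: ltW.
have climbN i j : (i <= j < N)%N ->
    climb b alpha (fun l => omega l w) i j <= (1 - delta) * ln t.
  by move=> /andP[ij jN]; rewrite -eu; apply: envU => //; rewrite ij ltnW.
apply: (le_trans (quenched_tail walk N0 t0 climbN)); rewrite lee_fin.
pose s := t `^ (delta / 2).
have sE : s = expR (delta / 2 * ln t) by rewrite /s /powR gt_eqF.
have N1 : (1 : R) <= N%:R by rewrite ler1n.
have NN : 8 * N%:R ^+ 2 <= s.
  rewrite sE; apply: le_trans (sizeV _ Vt); rewrite ler_wpM2l//.
  rewrite [2 * _]mulrC powRrM -powR_mulrn//.
  apply: ge0_ler_powR; rewrite ?nnegrE ?powR_ge0//.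
  apply: (@le_trans _ _ ((1 - epsilon) *
      (Cstar b alpha sigma2 * (expR u / u)) `^ alpha^-1)).
    by rewrite truncn_le mulr_ge0 ?powR_ge0 ?(ltW e1').
  apply: (@le_trans _ _ ((Cstar b alpha sigma2 * (expR u / u)) `^ alpha^-1)).
    by rewrite ger_pMl ?powR_gt0// gerBl ltW.
  apply: ge0_ler_powR; rewrite ?nnegrE ?invr_ge0 ?(ltW alpha_gt0)//.
  - exact: ltW.
  - exact/ltW/mulr_gt0.
  - by rewrite ler_wpM2l ?(ltW C0)// -eu.
have s8 : 8 <= s by apply: le_trans NN; rewrite ler_peMr// expr_ge1.
have gamma_t : (4 * N%:R ^+ 2 * expR ((1 - delta) * ln t))^-1 * t
    = s ^+ 2 / (4 * N%:R ^+ 2).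
  have tE : t = expR ((1 - delta) * ln t) * s ^+ 2.
    by rewrite sE -expRM_natl -expRD -[LHS]lnK ?posrE//; congr expR; field.
  rewrite {2}tE; field.
  by apply/andP; split; rewrite gt_eqF ?expR_gt0// (lt_le_trans _ N1).
have N20 : (0 : R) < 4 * N%:R ^+ 2.
  by rewrite mulr_gt0// exprn_gt0// (lt_le_trans _ N1).
rewrite mulNr gamma_t -/s.
have : 2 * s <= s ^+ 2 / (4 * N%:R ^+ 2).
  rewrite ler_pdivlMr// expr2; apply: le_trans (_ : s * (8 * N%:R ^+ 2) <= _).
    by rewrite le_eqVlt; apply/orP; left; apply/eqP; ring.
  by rewrite ler_wpM2l// (le_trans _ s8).
(* [2 s >= s + 1], and the factor [exp (-1)] pays for the constant 2. *)
move=> big; apply: (@le_trans _ _ (2 * expR (- s - 1))).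
  by rewrite ler_wpM2l// ler_expR; lra.
rewrite expRD expRN (_ : expR (- 1) = (expR 1)^-1) ?expRN//.
rewrite mulrCA ger_pMr ?invr_gt0 ?expR_gt0// ler_pdivrMr ?expR_gt0// mul1r.
by have := expR_ge1Dx (1 : R); lra.
Qed.
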